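(* Let $n\ge 3$ and $2\le j<n$ be integers, and let $f_0$ be a homogeneous plane curve singularity of order $n$. Then the jump of the Milnor number of $f_0$ in the class of linear deformations of order $j$, i.e. the smallest non-zero value of $\mu(f_0)-\mu(f_s)$ ($s\neq 0$ small) over all linear deformations $f_s=f_0+sg$ with $g$ a holomorphic function germ at $0\in\mathbb{C}^2$ and $\operatorname{ord} g=j$, is equal to $(n-j)(n-2)$.
   Context: A plane curve singularity is a non-zero reduced germ of a holomorphic function $f_0:(\mathbb{C}^2,0)\to(\mathbb{C},0)$. The order $\operatorname{ord} g$ of a holomorphic germ $g$ at $0$ is the lowest degree of a non-zero monomial in its Taylor expansion. A homogeneous singularity of order $n$ is a homogeneous polynomial of degree $n$ that is a product of $n$ pairwise non-proportional linear forms $ax+by$. The Milnor number at the origin is $\mu(f)=\dim_{\mathbb{C}}\mathcal{O}_{\mathbb{C}^2,0}/(\partial f/\partial x,\partial f/\partial y)$. A linear deformation of $f_0$ is a family $f_s=f_0+sg$, $s\in\mathbb{C}$ near $0$, with $g$ a holomorphic germ at $0$, $g(0,0)=0$; it is of order $j$ if $\operatorname{ord} g=j$. For all sufficiently small $s\ne 0$ the number $\mu(f_s)$ (at the origin) is constant and at most $\mu(f_0)$; the constant difference $\mu(f_0)-\mu(f_s)$, $s\neq 0$ small, is the jump of the deformation. The jump of $f_0$ in a class of deformations is the smallest non-zero jump of a deformation in that class. *)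

(* Defs.v *)
From HB Require Import structures.
From mathcomp Require Import all_boot all_order all_algebra.
From mathcomp Require Import boolp classical_sets reals topology normedtype.
From mathcomp Require Import complex.

Set Implicit Arguments.
Unset Strict Implicit.
Unset Printing Implicit Defensive.

Import Order.TTheory GRing.Theory Num.Theory.
Import numFieldNormedType.Exports.

Local Open Scope classical_set_scope.
Local Open Scope ring_scope.

(* The local ring O_{C^2,0} of holomorphic germs, represented by Taylor        *)
(* expansions, i.e. as the ring C{x,y} of convergent power series; a i j is    *)
(* the coefficient of x^i y^j.                                                 *)

Section Convergence.
Variable C : numFieldType.
Implicit Types (a b : nat -> nat -> C) (r M : C).

(* Absolute convergence at the point (r, r) for some r > 0, equivalently on    *)
(* some neighbourhood of the origin.  As an element of C, a positive r is      *)
(* automatically real.                                                         *)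
Definition abs_psum a r (N : nat) : C :=
  \sum_(i < N) \sum_(j < N) `|a i j| * r ^+ (i + j).

Definition convergent a :=
  exists r M, 0 < r /\ forall N, abs_psum a r N <= M.

Definition ser_mul a b (i j : nat) : C :=
  \sum_(k < i.+1) \sum_(l < j.+1) a k l * b (i - k)%N (j - l)%N.

Definition ser_mono (p q i j : nat) : C := ((i == p) && (j == q))%:R.

Let term_ge0 a r i j : 0 < r -> 0 <= `|a i j| * r ^+ (i + j).
Proof. by move=> r0; rewrite mulr_ge0 // exprn_ge0 // ltW. Qed.

Lemma abs_psum_le a r r' N : 0 < r -> r <= r' -> abs_psum a r N <= abs_psum a r' N.
Proof.
move=> r0 rr'; apply: ler_sum => i _; apply: ler_sum => j _.
rewrite ler_wpM2l //; apply: lerXn2r => //; rewrite nnegrE ltW //.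
exact: lt_le_trans rr'.
Qed.

Lemma convergent_common a b : convergent a -> convergent b ->
  exists r M M', [/\ 0 < r, forall N, abs_psum a r N <= M
                          & forall N, abs_psum b r N <= M'].
Proof.
move=> [r [M [r0 Ma]]] [r' [M' [r'0 Mb]]].
have s0 : 0 < r + r' by rewrite addr_gt0.
have p0 : 0 < r * r' / (r + r') by rewrite divr_gt0 ?mulr_gt0.
exists (r * r' / (r + r')), M, M'; split=> // N.
- apply: le_trans (abs_psum_le _ _ p0 _) (Ma N).
  by rewrite ler_pdivrMr // ler_pM2l // lerDr ltW.
- apply: le_trans (abs_psum_le _ _ p0 _) (Mb N).
  by rewrite ler_pdivrMr // mulrC ler_pM2l // lerDl ltW.
Qed.

Lemma convergentD a b : convergent a -> convergent b ->
  convergent (fun i j => a i j + b i j).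
Proof.
move=> ca cb; have [r [M [M' [r0 Ma Mb]]]] := convergent_common ca cb.
exists r, (M + M'); split=> // N; apply: le_trans (lerD (Ma N) (Mb N)).
rewrite -big_split; apply: ler_sum => i _; rewrite -big_split.
apply: ler_sum => j _ /=; rewrite -mulrDl ler_wpM2r ?ler_normD //.
by rewrite exprn_ge0 // ltW.
Qed.

Lemma convergentZ c a : convergent a -> convergent (fun i j => c * a i j).
Proof.
move=> [r [M [r0 Ma]]]; exists r, (`|c| * M); split=> // N.
apply: le_trans (ler_wpM2l (normr_ge0 c) (Ma N)).
rewrite mulr_sumr; apply: ler_sum => i _; rewrite mulr_sumr.
by apply: ler_sum => j _; rewrite normrM mulrA.
Qed.

Lemma convergent_mono p q : convergent (ser_mono p q).
Proof.
exists 1, 1; split=> // N.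
have le1 t : \sum_(i < N) (i == t :> nat)%:R <= 1 :> C.
  rewrite -natr_sum -big_mkcond (big_ord1_eq _ (fun=> 1%N)).
  by case: ifP => _; rewrite ?ler01.
apply: (@le_trans _ _ ((\sum_(i < N) (i == p :> nat)%:R)
                     * (\sum_(j < N) (j == q :> nat)%:R))).
  rewrite big_distrlr; apply: ler_sum => i _; apply: ler_sum => j _ /=.
  by rewrite expr1n mulr1 /ser_mono ger0_norm // -natrM mulnb.
by rewrite mulr_ile1 // sumr_ge0.
Qed.

Let conv1_le (u v : nat -> C) N : (forall i, 0 <= u i) -> (forall i, 0 <= v i) ->
  \sum_(i < N) \sum_(k < i.+1) u k * v (i - k)%N
    <= (\sum_(i < N) u i) * (\sum_(i < N) v i).
Proof.
move=> u0 v0.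
under eq_bigr => i _ do
  rewrite (big_ord_widen _ (fun k => u k * v (i - k)%N) (ltn_ord i)).
rewrite (exchange_big_dep xpredT) //= mulr_suml; apply: ler_sum => k _.
rewrite -mulr_sumr ler_wpM2l //.
have -> : \sum_(i < N | (k < i.+1)%N) v (i - k)%N = \sum_(i < N - k) v i.
  rewrite -(big_geq_mkord k N xpredT (fun i => v (i - k)%N)).
  rewrite -[X in \big[_/_]_(X <= _ < _) _]add0n big_addn big_mkord.
  by apply: eq_bigr => i _; rewrite addnK.
rewrite (big_ord_widen _ _ (leq_subr k N)) [leRHS](bigID (fun i : 'I_N => (i < N - k)%N)).
by rewrite lerDl sumr_ge0.
Qed.

Lemma convergentM a b : convergent a -> convergent b -> convergent (ser_mul a b).
Proof.
move=> ca cb; have [r [M [M' [r0 Ma Mb]]]] := convergent_common ca cb.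
pose al i j := `|a i j| * r ^+ (i + j); pose be i j := `|b i j| * r ^+ (i + j).
have al0 i j : 0 <= al i j by apply: term_ge0.
have be0 i j : 0 <= be i j by apply: term_ge0.
exists r, (M * M'); split=> // N.
have S0 (c : nat -> nat -> C) : 0 <= abs_psum c r N.
  by apply: sumr_ge0 => i _; apply: sumr_ge0 => j _; apply: term_ge0.
apply: (@le_trans _ _ (abs_psum a r N * abs_psum b r N)); last first.
  by rewrite ler_pM.
apply: (@le_trans _ _ (\sum_(i < N) \sum_(k < i.+1)
    (\sum_(j < N) al k j) * (\sum_(j < N) be (i - k)%N j))); last first.
  by apply: (conv1_le (u := fun k => \sum_(j < N) al k j)
    (v := fun k => \sum_(j < N) be k j)) => i; apply: sumr_ge0.
apply: ler_sum => i _.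
apply: (@le_trans _ _ (\sum_(k < i.+1) \sum_(j < N) \sum_(l < j.+1)
    al k l * be (i - k)%N (j - l)%N)); last first.
  by apply: ler_sum => k _; apply: (conv1_le (u := al k) (v := be (i - k)%N)).
rewrite exchange_big; apply: ler_sum => j _ /=.
apply: le_trans (ler_wpM2r _ (ler_norm_sum _ _ _)) _.
  by rewrite exprn_ge0 // ltW.
rewrite mulr_suml; apply: ler_sum => k _.
apply: le_trans (ler_wpM2r _ (ler_norm_sum _ _ _)) _.
  by rewrite exprn_ge0 // ltW.
rewrite mulr_suml; apply: ler_sum => l _.
rewrite normrM /al /be mulrACA -exprD.
have -> : (k + l + (i - k + (j - l)) = i + j)%N.
  by rewrite addnACA !subnKC // -ltnS.
by [].
Qed.

Definition ser_dx a (i j : nat) : C := a i.+1 j *+ i.+1.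
Definition ser_swap a (i j : nat) : C := a j i.

Lemma convergent_swap a : convergent a -> convergent (ser_swap a).
Proof.
move=> [r [M [r0 Ma]]]; exists r, M; split=> // N.
rewrite /abs_psum exchange_big; apply: le_trans (Ma N).
by apply: ler_sum => i _; apply: ler_sum => j _; rewrite addnC.
Qed.

Lemma convergent_dx a : convergent a -> convergent (ser_dx a).
Proof.
move=> [r [M [r0 Ma]]]; exists (r / 2), (r^-1 * M); split; first by rewrite divr_gt0.
move=> N; apply: le_trans (ler_wpM2l _ (Ma N.+1)); last by rewrite invr_ge0 ltW.
have t0 i j : 0 <= `|a i j| * r ^+ (i + j) by apply: term_ge0.
have ri0 : 0 <= r^-1 by rewrite invr_ge0 ltW.
rewrite mulr_sumr big_ord_recl /=; apply: ler_wpDl.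
  by apply: mulr_ge0 => //; apply: sumr_ge0.
apply: ler_sum => i _; rewrite mulr_sumr big_ord_recr /=; apply: ler_wpDr.
  by apply: mulr_ge0.
apply: ler_sum => j _; rewrite /bump /= add1n addSn exprS.
rewrite [leRHS]mulrCA [r^-1 * _]mulKf ?gt_eqF //.
rewrite normrMn exprMn mulrnAl -mulrnAr ler_wpM2l //.
rewrite -mulrnAr -[leRHS]mulr1 ler_wpM2l ?exprn_ge0 ?(ltW r0) //.
rewrite exprVn -[_ *+ i.+1]mulr_natl ler_pdivrMr ?exprn_gt0 // mul1r -natrX ler_nat.
exact: leq_trans (ltn_expl i (ltnSn 1)) (leq_pexp2l _ (leq_addr _ _)).
Qed.

End Convergence.

Record germ (C : numFieldType) := Germ {
  coef :> nat -> nat -> C;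
  coefP : convergent coef
}.
Arguments Germ {C} coef coefP.

Section Ring.
Variable C : numFieldType.
Implicit Types f g h : germ C.

Lemma germP f g : (forall i j, f i j = g i j) -> f = g.
Proof.
case: f g => [a ca] [b cb] /= e.
have {}e : a = b by apply/funext => i; apply/funext => j.
by case: _ / e in cb *; congr Germ; apply: Prop_irrelevance.
Qed.

HB.instance Definition _ := gen_eqMixin (germ C).
HB.instance Definition _ := gen_choiceMixin (germ C).

Definition germ_mono p q : germ C := Germ (ser_mono C p q) (convergent_mono C p q).
Definition germ_scale c f : germ C := Germ (fun i j => c * f i j) (convergentZ c (coefP f)).
Definition germ_add f g : germ C :=
  Germ (fun i j => f i j + g i j) (convergentD (coefP f) (coefP g)).
Definition germ_mul f g : germ C := Germ (ser_mul f g) (convergentM (coefP f) (coefP g)).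

Let zero := germ_scale 0 (germ_mono 0 0).
Let opp := germ_scale (-1).

Let addA : associative germ_add.
Proof. by move=> f g h; apply: germP => i j /=; rewrite addrA. Qed.
Let addC : commutative germ_add.
Proof. by move=> f g; apply: germP => i j /=; rewrite addrC. Qed.
Let add0 : left_id zero germ_add.
Proof. by move=> f; apply: germP => i j /=; rewrite mul0r add0r. Qed.
Let addN : left_inverse zero opp germ_add.
Proof. by move=> f; apply: germP => i j /=; rewrite mul0r mulN1r addNr. Qed.

HB.instance Definition _ := GRing.isZmodule.Build (germ C) addA addC add0 addN.

Let trunc N (a : nat -> nat -> C) : {poly {poly C}} :=
  \poly_(i < N) \poly_(j < N) a i j.

Let coef_trunc N a i j : (i < N)%N -> (j < N)%N -> (trunc N a)`_i`_j = a i j.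
Proof. by move=> iN jN; rewrite /trunc coef_poly iN coef_poly jN. Qed.

Let coef_polyM (p q : {poly {poly C}}) i j :
  (p * q)`_i`_j = ser_mul (fun i j => p`_i`_j) (fun i j => q`_i`_j) i j.
Proof.
by rewrite coefM coef_sum; apply: eq_bigr => k _; rewrite coefM.
Qed.

Let ser_mul_eq a a' b b' N i j : (i < N)%N -> (j < N)%N ->
  (forall i j, (i < N)%N -> (j < N)%N -> a i j = a' i j) ->
  (forall i j, (i < N)%N -> (j < N)%N -> b i j = b' i j) ->
  @ser_mul C a b i j = ser_mul a' b' i j.
Proof.
move=> iN jN ea eb; apply: eq_bigr => k _; apply: eq_bigr => l _.
by rewrite ea ?eb // ?(leq_ltn_trans (leq_subr _ _)) //;
   apply: leq_trans (ltn_ord _) _.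
Qed.

Let mulA : associative germ_mul.
Proof.
move=> f g h; apply: germP => i j.
pose N := (maxn i j).+1.
have iN : (i < N)%N by rewrite ltnS leq_maxl.
have jN : (j < N)%N by rewrite ltnS leq_maxr.
pose F := trunc N f; pose G := trunc N g; pose H := trunc N h.
transitivity (F * (G * H))`_i`_j.
  rewrite coef_polyM; apply: (ser_mul_eq iN jN) => k l kN lN.
    by rewrite coef_trunc.
  by rewrite coef_polyM; apply: (ser_mul_eq kN lN) => *; rewrite coef_trunc.
rewrite mulrA coef_polyM; apply/esym/(ser_mul_eq iN jN) => k l kN lN.
  by rewrite coef_polyM; apply: (ser_mul_eq kN lN) => *; rewrite coef_trunc.
by rewrite coef_trunc.
Qed.

Let mulC : commutative germ_mul.
Proof.
move=> f g; apply: germP => i j /=.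
rewrite /ser_mul (reindex_inj rev_ord_inj); apply: eq_bigr => k _ /=.
rewrite (reindex_inj rev_ord_inj); apply: eq_bigr => l _ /=.
by rewrite !subSS !subKn 1?mulrC // -ltnS.
Qed.

Let mul1 : left_id (germ_mono 0 0) germ_mul.
Proof.
move=> f; apply: germP => i j /=; rewrite /ser_mul big_ord_recl.
rewrite big_ord_recl /= /ser_mono /= mul1r !subn0.
rewrite !big1 ?addr0 // => k _; last by rewrite mul0r.
by rewrite big1 // => l _; rewrite mul0r.
Qed.

Let mulD : left_distributive germ_mul germ_add.
Proof.
move=> f g h; apply: germP => i j /=; rewrite /ser_mul -big_split.
apply: eq_bigr => k _; rewrite -big_split; apply: eq_bigr => l _ /=.
by rewrite mulrDl.
Qed.

Let one_neq0 : germ_mono 0 0 != 0.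
Proof.
apply/eqP => /(congr1 (fun f : germ C => f 0%N 0%N)) /= /eqP.
by rewrite mul0r /ser_mono /= oner_eq0.
Qed.

HB.instance Definition _ :=
  GRing.Zmodule_isComNzRing.Build (germ C) mulA mulC mul1 mulD one_neq0.

Let scaleA c d f : germ_scale c (germ_scale d f) = germ_scale (c * d) f.
Proof. by apply: germP => i j /=; rewrite mulrA. Qed.
Let scale1 : left_id 1 germ_scale.
Proof. by move=> f; apply: germP => i j /=; rewrite mul1r. Qed.
Let scaleDr : right_distributive germ_scale +%R.
Proof. by move=> c f g; apply: germP => i j /=; rewrite mulrDr. Qed.
Let scaleDl f : {morph germ_scale^~ f : c d / c + d}.
Proof. by move=> c d; apply: germP => i j /=; rewrite mulrDl. Qed.

HB.instance Definition _ :=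
  GRing.Zmodule_isLmodule.Build C (germ C) scaleA scale1 scaleDr scaleDl.

Let scaleAl c f g : c *: (f * g) = (c *: f) * g.
Proof.
apply: germP => i j /=; rewrite /ser_mul mulr_sumr; apply: eq_bigr => k _.
by rewrite mulr_sumr; apply: eq_bigr => l _ /=; rewrite mulrA.
Qed.

HB.instance Definition _ := GRing.Lmodule_isLalgebra.Build C (germ C) scaleAl.

Lemma germ_coefD f g i j : (f + g) i j = f i j + g i j. Proof. by []. Qed.
Lemma germ_coefZ c f i j : (c *: f) i j = c * f i j. Proof. by []. Qed.
Lemma germ_coefM f g i j : (f * g) i j =
  \sum_(k < i.+1) \sum_(l < j.+1) f k l * g (i - k)%N (j - l)%N.
Proof. by []. Qed.
Lemma germ_coef1 i j : (1 : germ C) i j = ((i == 0%N) && (j == 0%N))%:R.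
Proof. by []. Qed.
Lemma germ_coef0 i j : (0 : germ C) i j = 0. Proof. exact: mul0r. Qed.

Definition varX : germ C := germ_mono 1 0.
Definition varY : germ C := germ_mono 0 1.

Definition dx f : germ C := Germ (ser_dx f) (convergent_dx (coefP f)).
Definition dy f : germ C :=
  Germ (ser_swap (ser_dx (ser_swap f)))
    (convergent_swap (convergent_dx (convergent_swap (coefP f)))).

Lemma dyE f i j : dy f i j = f i j.+1 *+ j.+1. Proof. by []. Qed.

End Ring.
Arguments varX {C}.
Arguments varY {C}.

(* d = dim (V / J) for a linear subspace J of V, d finite: the classes of      *)
(* e_0, ..., e_(d-1) form a basis of V / J.                                    *)
Definition codim_is (C : fieldType) (V : lmodType C) (J : set V) (d : nat) :=
  exists e : 'I_d -> V,
    forall h : V, exists! c : 'rV[C]_d, J (h - \sum_k c 0 k *: e k).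

Section Milnor.
Variable C : numFieldType.
Implicit Types f g h : germ C.

Definition jacobian_ideal f : set (germ C) :=
  [set h | exists u v : germ C, h = u * dx f + v * dy f].

(* mu(f) is finite and equal to m. *)
Definition milnor f (m : nat) := codim_is (jacobian_ideal f) m.

Definition order_is f (m : nat) :=
  (forall i j, (i + j < m)%N -> f i j = 0) /\
  (exists i j, (i + j)%N = m /\ f i j != 0).

Definition linear_form (l : C * C) : germ C := l.1 *: varX + l.2 *: varY.

Definition proportional g h := exists c : C, g = c *: h.

Definition homogeneous_singularity (n : nat) f :=
  exists l : 'I_n -> C * C,
    (forall i k, i != k -> ~ proportional (linear_form (l i)) (linear_form (l k))) /\
    f = \prod_i linear_form (l i).

(* mu(f0) - mu(f0 + s g) = d for all small s != 0. *)
Definition jump_of_deformation f0 g (d : nat) :=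
  exists m0 m : nat, [/\ milnor f0 m0, m0 = (m + d)%N
    & \forall s \near 0^', milnor (f0 + s *: g) m].

(* d is the jump of f0 in the class of linear deformations f0 + s g of order j *)
Definition jump_linear_order_is f0 (j d : nat) :=
  let J := [set e : nat | (0 < e)%N /\ exists g,
              [/\ g 0%N 0%N = 0, order_is g j & jump_of_deformation f0 g e]] in
  J d /\ forall e, J e -> (d <= e)%N.

End Milnor.

(* Main.v *)
Require Import Defs.
From mathcomp Require Import all_boot all_order all_algebra.
From mathcomp Require Import reals complex.
From HB Require Import structures.
From mathcomp Require Import boolp classical_sets topology normedtype.
From mathcomp Require Import ring zify.

(** The deformation [f0 + s l^j], with [l] a linear factor of [f0 = l Q], attains the bound: its
    derivative along the line [l = 0] is the form [l * D Q], a product of linear forms, so that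
    its Milnor number is a sum of orders of the other derivative restricted to lines,
    [(n - 1) + (n - 2) (j - 1)].

    Conversely let [G] be the initial form of [g].  Rescaling [(x, y)] to [(t x, t y)] with
    [s = t^(n-j)] turns [f0 + s g] into a family with value [H = f0 + G] at [t = 0], and
    semicontinuity gives [mu(f0 + s g) <= mu(H)].  For a generic derivation [D] the ideals
    [(D H, J)] and [(D H, D G * dy H)] coincide, where [J] is the Jacobian determinant of [f0]
    and [G]; both [J] and [D G] are products of linear forms, so this computes [mu(H)].  The
    lines on which [D H] has order [n - 1] instead of [j - 1] are the multiple lines of [G];
    as [f0] is reduced, such a line has in [J] at most its multiplicity in [G], so at most [j]
    of the factors of [J] are of this kind. *)

Set Implicit Arguments.
Unset Strict Implicit.
Unset Printing Implicit Defensive.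

Import Order.TTheory GRing.Theory Num.Theory.
Import numFieldNormedType.Exports.

Local Open Scope ring_scope.

(** * Convergence and derivations of germs *)
Section Bounds.
Variable C : numFieldType.
Implicit Types (a : nat -> nat -> C).

(** The derivatives of [H] are in general not homogeneous, so they need not be products of lines,
    and mu(H) cannot be read off from orders on lines. The Jacobian determinant helps because it is
    homogeneous: modulo [D H] one has [D f0 = - D G], so J = D f0 * dy G - dy f0 * D G becomes - D G
    * dy H. As (D H, dy H) is the Jacobian ideal of [H], additivity of codimension in the second
    generator gives mu(H) = codim (D H, J) - codim (D H, D G), a difference of two sums of orders of
    [D H] on lines. Genericity of [D] ensures that [D H] vanishes on none of these lines. The
    resulting bound coincides with the Milnor number of the special deformation, hence the exact
    minimum.

    The rescaled family depends polynomially on t, so semicontinuity holds outside the roots of one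
    polynomial. A single small positive t suffices, since mu(f0 + s g) is constant for all small
    non-zero s. *)

Lemma convergentP a : convergent a <->
  exists A B, [/\ 0 <= A, 0 < B & forall i j, `|a i j| <= A * B ^+ (i + j)].
Proof.
split=> [[r [M [r0 hM]]]|[A [B [A0 B0 h]]]].
  have t0 i j : 0 <= `|a i j| * r ^+ (i + j) by rewrite mulr_ge0 // exprn_ge0 // ltW.
  exists M, r^-1; split; last 1 first.
  - move=> i j; rewrite exprVn ler_pdivlMr ?exprn_gt0 //.
    apply: le_trans (hM (maxn i j).+1).
    have iN : (i < (maxn i j).+1)%N by rewrite ltnS leq_maxl.
    have jN : (j < (maxn i j).+1)%N by rewrite ltnS leq_maxr.
    rewrite /abs_psum (bigD1 (Ordinal iN)) //= (bigD1 (Ordinal jN)) //= -addrA lerDl.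
    rewrite addr_ge0 // sumr_ge0 // => k _.
    by apply: sumr_ge0.
  - by apply: le_trans (hM 0%N); rewrite /abs_psum big_ord0.
  - by rewrite invr_gt0.
(* At this radius the double sum is at most [A] times the product of two geometric series of ratio
   1/2, each bounded by 2. *)
exists (2 * B)^-1, (A * (2 * 2)); split; first by rewrite invr_gt0 mulr_gt0.
move=> N.
have geo n : \sum_(i < n) (2^-1 : C) ^+ i <= 2.
  suff: \sum_(i < n) (2^-1 : C) ^+ i = 2 - 2 * 2^-1 ^+ n.
    by move=> ->; rewrite lerBlDr lerDl mulr_ge0 // exprn_ge0 // invr_ge0.
  elim: n => [|n IH]; first by rewrite big_ord0 expr0 mulr1 subrr.
  by rewrite big_ord_recr /= IH exprS; field.
apply: (@le_trans _ _ (A * ((\sum_(i < N) 2^-1 ^+ i) * (\sum_(i < N) 2^-1 ^+ i)))).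
  rewrite big_distrlr /= mulr_sumr; apply: ler_sum => i _; rewrite mulr_sumr.
  apply: ler_sum => j _.
  apply: le_trans (ler_wpM2r _ (h i j)) _.
    by rewrite exprn_ge0 // invr_ge0 mulr_ge0 // ltW.
  by rewrite -mulrA ler_wpM2l // -exprMn -exprD invfM mulrCA divff ?mulr1 ?gt_eqF.
have S0 : 0 <= \sum_(i < N) (2^-1 : C) ^+ i.
  by apply: sumr_ge0 => i _; rewrite exprn_ge0 // invr_ge0.
by rewrite ler_wpM2l // ler_pM.
Qed.

Lemma sum_expr_le (x : C) n : 0 <= x -> \sum_(k < n.+1) x ^+ k <= (1 + x) ^+ n.
Proof.
move=> x0; elim: n => [|n IH]; first by rewrite big_ord1 !expr0.
rewrite big_ord_recl /= expr0.
under eq_bigr do rewrite /bump /= add1n exprS.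
rewrite -mulr_sumr [leRHS]exprS mulrDl mul1r lerD ?ler_wpM2l //.
by rewrite exprn_ege1 // lerDl.
Qed.

(** A single criterion for germs obtained by shifting, cutting or rescaling coefficients: [u] and
    [v] absorb a shift, [q] a dilation. *)
Lemma convergent_dom a b (u v : nat) (q : C) : 0 <= q -> convergent a ->
  (forall i j, `|b i j| <= `|a (i + u)%N (j + v)%N| * q ^+ (i + j)) -> convergent b.
Proof.
move=> q0 /convergentP[A [B [A0 B0 h]]] hb.
have B1 : 0 < B * (q + 1) by rewrite mulr_gt0 // ltr_wpDl.
apply/convergentP; exists (A * B ^+ (u + v)), (B * (q + 1)); split=> //.
  by rewrite mulr_ge0 // exprn_ge0 // ltW.
move=> i j; apply: le_trans (hb i j) _.
apply: le_trans (ler_wpM2r _ (h _ _)) _; first exact: exprn_ge0.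
rewrite addnACA exprD -!mulrA ler_wpM2l // mulrCA ler_wpM2l //.
  by rewrite exprn_ge0 // ltW.
by rewrite exprMn ler_wpM2l ?exprn_ge0 ?(ltW B0) // lerXn2r ?nnegrE ?addr_ge0 // lerDl.
Qed.

End Bounds.

Section GermBasics.
Variable C : numFieldType.
Implicit Types (f g h z : germ C).

Lemma germ_monoM p q f i j :
  (germ_mono C p q * f) i j = if (p <= i)%N && (q <= j)%N then f (i - p)%N (j - q)%N else 0.
Proof.
rewrite germ_coefM.
have E (k : 'I_i.+1) (l : 'I_j.+1) : germ_mono C p q k l * f (i - k)%N (j - l)%N =
  if (k == p :> nat) then if (l == q :> nat) then f (i - p)%N (j - q)%N else 0 else 0.
  rewrite /= /ser_mono.
  case: eqP => [->|] /=; last by rewrite mul0r.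
  by case: eqP => [->|] /=; rewrite ?mul0r ?mul1r.
under eq_bigr do under eq_bigr do rewrite E.
case: leqP => /= [pi|ip]; last first.
  rewrite big1 // => k _; rewrite big1 // => l _; case: eqP => // kp.
  by have := ltn_ord k; rewrite kp ltnS leqNgt ip.
rewrite (bigD1 (Ordinal (pi : (p < i.+1)%N))) //= eqxx [X in _ + X]big1 ?addr0; last first.
  move=> k kp; rewrite big1 // => l _; case: eqP => // e.
  by case/eqP: kp; apply: val_inj.
case: leqP => /= [qj|jq]; last first.
  rewrite big1 // => l _; case: eqP => // lq.
  by have := ltn_ord l; rewrite lq ltnS leqNgt jq.
rewrite (bigD1 (Ordinal (qj : (q < j.+1)%N))) //= eqxx [X in _ + X]big1 ?addr0 //.
by move=> l lq; case: eqP => // e; case/eqP: lq; apply: val_inj.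
Qed.

Lemma varXM f i j : (varX * f) i j = if i is i'.+1 then f i' j else 0.
Proof. by rewrite germ_monoM; case: i => [|i] //=; rewrite !subn0 subn1. Qed.

Lemma varYM f i j : (varY * f) i j = if j is j'.+1 then f i j' else 0.
Proof. by rewrite germ_monoM; case: j => [|j] //=; rewrite !subn0 subn1. Qed.

Lemma germ_monoD p q p' q' :
  germ_mono C p q * germ_mono C p' q' = germ_mono C (p + p') (q + q').
Proof.
apply: germP => i j; rewrite germ_monoM /= /ser_mono.
case: leqP => /= [pi|ip]; last first.
  by case: eqP => // e; move: ip; rewrite e ltnNge leq_addr.
case: leqP => /= [qj|jq]; last first.
  by rewrite andbC; case: eqP => // e; move: jq; rewrite e ltnNge leq_addr.
by rewrite -(eqn_add2l p) subnKC // -(eqn_add2l q (j - q)) subnKC.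
Qed.

Lemma germ_coef_sum I (r : seq I) P (F : I -> germ C) i j :
  (\sum_(k <- r | P k) F k) i j = \sum_(k <- r | P k) F k i j.
Proof.
elim/big_rec2: _ => [|k x y _ <-]; last by rewrite germ_coefD.
by rewrite germ_coef0.
Qed.

Lemma germ_coefN f i j : (- f) i j = - f i j.
Proof. by rewrite -scaleN1r germ_coefZ mulN1r. Qed.

Lemma germ_coefB f g i j : (f - g) i j = f i j - g i j.
Proof. by rewrite germ_coefD germ_coefN. Qed.

Lemma germ_scalerAr (c : C) f g : c *: (f * g) = f * (c *: g).
Proof. by rewrite mulrC scalerAl mulrC. Qed.

Lemma dxD f g : dx (f + g) = dx f + dx g.
Proof. by apply: germP => i j; rewrite /= /ser_dx /= mulrnDl. Qed.
Lemma dyD f g : dy (f + g) = dy f + dy g.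
Proof. by apply: germP => i j; rewrite /= /ser_swap /ser_dx /= mulrnDl. Qed.
Lemma dxZ c f : dx (c *: f) = c *: dx f.
Proof. by apply: germP => i j; rewrite /= /ser_dx /= mulrnAr. Qed.
Lemma dyZ c f : dy (c *: f) = c *: dy f.
Proof. by apply: germP => i j; rewrite /= /ser_swap /ser_dx /= mulrnAr. Qed.

Lemma dxE f i j : dx f i j = f i.+1 j *+ i.+1. Proof. by []. Qed.

Lemma dxM f g : dx (f * g) = dx f * g + f * dx g.
Proof.
apply: germP => i j; rewrite germ_coefD dxE !germ_coefM.
have -> : (\sum_(k < i.+2) \sum_(l < j.+1) f k l * g (i.+1 - k)%N (j - l)%N) *+ i.+1
  = \sum_(k < i.+2) \sum_(l < j.+1) (f k l *+ k) * g (i.+1 - k)%N (j - l)%N +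
    \sum_(k < i.+2) \sum_(l < j.+1) f k l * (g (i.+1 - k)%N (j - l)%N *+ (i.+1 - k)).
  rewrite -sumrMnl -big_split; apply: eq_bigr => k _.
  rewrite -sumrMnl -big_split; apply: eq_bigr => l _ /=.
  by rewrite mulrnAl mulrnAr -mulrnDr subnKC // -ltnS.
congr (_ + _).
  rewrite big_ord_recl /= [X in X + _]big1 ?add0r => [|l _]; last by rewrite mulr0n mul0r.
  by apply: eq_bigr => k _; rewrite /bump /= add1n subSS.
rewrite big_ord_recr /= [X in _ + X]big1 ?addr0 => [|l _]; last first.
  by rewrite subnn mulr0n mulr0.
by apply: eq_bigr => k _; rewrite subSn // -ltnS.
Qed.

Definition germ_swap f : germ C := Germ (ser_swap f) (convergent_swap (coefP f)).

Lemma germ_swapM f g : germ_swap (f * g) = germ_swap f * germ_swap g.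
Proof. by apply: germP => i j; rewrite germ_coefM [LHS]exchange_big. Qed.

Lemma dyM f g : dy (f * g) = dy f * g + f * dy g.
Proof.
have dyE' h : dy h = germ_swap (dx (germ_swap h)) by exact: germP.
have swD a b : germ_swap (a + b) = germ_swap a + germ_swap b by exact: germP.
have swK a : germ_swap (germ_swap a) = a by exact: germP.
by rewrite !dyE' germ_swapM dxM swD !germ_swapM !swK.
Qed.

End GermBasics.

(** * Restriction to lines through the origin *)
Section Lines.
Variable C : numFieldType.
Implicit Types (f g h z : germ C) (p q : option C).

(* A point [p] of the projective line: [Some c] is the line [x = c y], [None] is [y = 0]. *)
Definition line p : germ C := if p is Some c then varX - c *: varY else varY.
Definition pt p : C * C := if p is Some c then (c, 1) else (1, 0).
(* The coefficient of [t ^+ d] in the restriction of [f] to the line [t |-> t * pt p]. *)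
Definition ev p (f : nat -> nat -> C) (d : nat) : C :=
  \sum_(i < d.+1) f i (d - i)%N * ((pt p).1 ^+ i * (pt p).2 ^+ (d - i)).

Lemma evD p f g d : ev p (f + g) d = ev p f d + ev p g d.
Proof. by rewrite /ev -big_split; apply: eq_bigr => i _; rewrite germ_coefD mulrDl /=. Qed.

Lemma evZ p c f d : ev p (c *: f) d = c * ev p f d.
Proof. by rewrite /ev mulr_sumr; apply: eq_bigr => i _; rewrite germ_coefZ -mulrA. Qed.

Lemma evN p f d : ev p (- f) d = - ev p f d.
Proof. by rewrite -scaleN1r evZ mulN1r. Qed.

Lemma ev0 p d : ev p (0 : germ C) d = 0.
Proof. by rewrite -(scale0r 0) evZ mul0r. Qed.

Lemma ev_sum p I (r : seq I) (P : pred I) (F : I -> germ C) d :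
  ev p (\sum_(i <- r | P i) F i) d = \sum_(i <- r | P i) ev p (F i) d.
Proof.
elim/big_rec2: _ => [|i x y _ <-]; first by rewrite ev0.
by rewrite evD.
Qed.

Lemma evNone (f : nat -> nat -> C) d : ev None f d = f d 0%N.
Proof.
rewrite /ev big_ord_recr /= subnn expr1n !mulr1 big1 ?add0r // => i _.
by rewrite expr1n mul1r expr0n subn_eq0 leqNgt ltn_ord /= mulr0.
Qed.

Lemma evSome c (f : nat -> nat -> C) d : ev (Some c) f d = \sum_(i < d.+1) f i (d - i)%N * c ^+ i.
Proof. by apply: eq_bigr => i _; rewrite /= expr1n mulr1. Qed.

(** An auxiliary variable marks the power of x, so that [evM] becomes an identity between
    coefficients of polynomials. *)
Let hpoly p (f : nat -> nat -> C) d : {poly C} :=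
  \poly_(i < d.+1) (f i (d - i)%N * ((pt p).1 ^+ i * (pt p).2 ^+ (d - i))).

Let ev_hpoly p f d : ev p f d = (hpoly p f d).[1].
Proof. by rewrite horner_poly; apply: eq_bigr => i _; rewrite expr1n mulr1. Qed.

Let hpolyM p f g d : hpoly p (f * g) d = \sum_(k < d.+1) hpoly p f k * hpoly p g (d - k).
Proof.
apply/polyP => i; rewrite coef_sum coef_poly.
under eq_bigr do rewrite coefM.
rewrite exchange_big /=.
case: ltnP => [|id]; last first.
  rewrite big1 // => k' _; rewrite big1 // => k _; rewrite !coef_poly !ltnS.
  have := ltn_ord k; have := ltn_ord k'; rewrite !ltnS => ki kd.
  case: leqP => k'k; last by rewrite mul0r.
  case: leqP => kk; last by rewrite mulr0.
  lia.
rewrite ltnS => id; rewrite /ser_mul mulr_suml; apply: eq_bigr => k' _.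
have k'i : (k' <= i)%N by rewrite -ltnS.
rewrite -(big_mkord xpredT (fun k => (hpoly p f k)`_k' * (hpoly p g (d - k))`_(i - k'))).
(* With exponent [k'] of x in the first factor, its total degree k contributes only for k' <= k <=
   k' + (d - i); the truncation in [hpoly] kills the other terms. *)
rewrite (@big_cat_nat _ _ _ k') //=; last by lia.
rewrite [X in X + _]big_nat [X in X + _]big1 ?add0r; last first.
  by move=> k /andP[_ kk']; rewrite coef_poly ltnS leqNgt kk' mul0r.
rewrite (@big_cat_nat _ _ _ (k' + (d - i).+1)) //=; [|by lia|by lia].
rewrite [X in _ + X]big_nat [X in _ + X]big1 ?addr0; last first.
  move=> k /andP[kk' kd]; rewrite [(hpoly p g _)`_ _]coef_poly.
  rewrite ltnS leqNgt; have -> : (d - k < i - k')%N; [lia | by rewrite /= mulr0].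
rewrite -[X in \big[_/_]_(X <= _ < _) _]add0n big_addn addKn big_mkord mulr_suml.
apply: eq_bigr => l _; have := ltn_ord l; rewrite ltnS => ldi.
rewrite !coef_poly.
have -> : (k' < (l + k').+1)%N by lia.
have -> : (i - k' < (d - (l + k')).+1)%N by lia.
rewrite addnK.
have -> : (d - (l + k') - (i - k') = d - i - l)%N by lia.
have wi x : x ^+ i = x ^+ k' * x ^+ (i - k') :> C by rewrite -exprD subnKC.
have wd x : x ^+ (d - i) = x ^+ l * x ^+ (d - i - l) :> C by rewrite -exprD subnKC.
rewrite wi wd; ring.
Qed.

Lemma evM p f g d : ev p (f * g) d = \sum_(k < d.+1) ev p f k * ev p g (d - k)%N.
Proof.
rewrite ev_hpoly hpolyM horner_sum; apply: eq_bigr => k _.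
by rewrite hornerM !ev_hpoly.
Qed.

Definition vanish p f := forall d, ev p f d = 0.

Lemma vanishMl p f g : vanish p f -> vanish p (f * g).
Proof. by move=> v d; rewrite evM big1 // => k _; rewrite v mul0r. Qed.

Lemma evM_low p f g k d : (forall i, (i < k)%N -> ev p f i = 0) ->
  (forall i, (i < d)%N -> ev p g i = 0) -> ev p (f * g) (k + d) = ev p f k * ev p g d.
Proof.
move=> hf hg; rewrite evM.
have kkd : (k < (k + d).+1)%N by rewrite ltnS leq_addr.
rewrite (bigD1 (Ordinal kkd)) //= addKn big1 ?addr0 // => i ik.
have {}ik : i != k :> nat by apply: contra ik => /eqP e; apply/eqP/val_inj.
case: (ltngtP i k) ik => // ik _; first by rewrite hf ?mul0r.
by rewrite hg ?mulr0 //; have := ltn_ord i; lia.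
Qed.

Lemma vanishPn p f : ~ vanish p f ->
  exists k, ev p f k != 0 /\ forall i, (i < k)%N -> ev p f i = 0.
Proof.
move=> nv; have ex : exists k, ev p f k != 0.
  apply: contrapT => ne; apply: nv => d; apply/eqP; apply: contrapT => /negP h.
  by apply: ne; exists d.
exists (ex_minn ex); case: ex_minnP => k fk hk; split=> // i ik.
by apply/eqP; apply: contraLR ik => /hk; rewrite -leqNgt.
Qed.

Lemma vanishM p f g : vanish p (f * g) -> vanish p f \/ vanish p g.
Proof.
move=> v; apply: contrapT => /not_orP[/vanishPn[k [fk hk]] /vanishPn[d [gd hd]]].
have := v (k + d)%N; rewrite evM_low // => /eqP.
by rewrite mulf_eq0 (negPf fk) (negPf gd).
Qed.

Lemma lineM_Some c z i j : (line (Some c) * z) i j =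
  (if i is i'.+1 then z i' j else 0) - c * (if j is j'.+1 then z i j' else 0).
Proof. by rewrite mulrBl germ_coefB -scalerAl germ_coefZ varXM varYM. Qed.

Lemma ev_varX p d : ev p varX d = if d == 1%N then (pt p).1 else 0.
Proof.
rewrite /ev /= /ser_mono; move: d => [|[|d]] /=.
- by rewrite big_ord1 /= mul0r.
- by rewrite big_ord_recr big_ord1 /= mul0r add0r mul1r expr1 expr0 mulr1.
- rewrite big1 // => i _; rewrite andbC; case: eqP => [/eqP|_]; last by rewrite mul0r.
  rewrite subn_eq0 => di; rewrite (_ : _ == 1%N = false) ?mul0r //=.
  by apply/negP => /eqP e; rewrite e in di.
Qed.

Lemma ev_varY p d : ev p varY d = if d == 1%N then (pt p).2 else 0.
Proof.
rewrite /ev /= /ser_mono; move: d => [|[|d]] /=.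
- by rewrite big_ord1 /= mul0r.
- by rewrite big_ord_recr big_ord1 /= mul0r addr0 mul1r expr1 expr0 mul1r.
- by rewrite big1 // => i _; case: eqP => [->|_]; rewrite /= mul0r.
Qed.

Lemma ev_line p q d : ev p (line q) d =
  if d == 1%N then (if q is Some c then (pt p).1 - c * (pt p).2 else (pt p).2) else 0.
Proof.
case: q => [c|]; last exact: ev_varY.
rewrite /line evD evN evZ ev_varX ev_varY.
by case: eqP => // _; rewrite mulr0 subrr.
Qed.

Lemma ev_line_eq0 p q : (ev p (line q) 1 == 0) = (p == q).
Proof.
rewrite ev_line eqxx; case: p q => [a|] [b|] //=.
- by rewrite mulr1 subr_eq0.
- by rewrite oner_eq0.
- by rewrite mulr0 subr0 oner_eq0.
- by rewrite eqxx.
Qed.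

Lemma vanish_line p : vanish p (line p).
Proof.
move=> d; rewrite ev_line; case: eqP => // _.
by case: p => //= c; rewrite mulr1 subrr.
Qed.

Lemma line_regular p z : line p * z = 0 -> z = 0.
Proof.
move=> e; apply: germP => i j; rewrite germ_coef0.
case: p e => [c|] e; last first.
  by have := congr1 (fun f : germ C => f i j.+1) e; rewrite varYM germ_coef0.
elim: j i => [|j IH] i.
  have := congr1 (fun f : germ C => f i.+1 0%N) e.
  by rewrite lineM_Some germ_coef0 mulr0 subr0.
have := congr1 (fun f : germ C => f i.+1 j.+1) e.
by rewrite lineM_Some germ_coef0 IH mulr0 subr0.
Qed.

Lemma line_dvd p h : vanish p h -> exists z, h = line p * z.
Proof.
case: p => [c|] v; last first.
  have cz : convergent (fun i j => h i j.+1).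
    apply: (@convergent_dom _ h _ 0 1 1) => // [|i j]; first exact: coefP.
    by rewrite expr1n mulr1 addn0 addn1.
  exists (Germ _ cz); apply: germP => i [|j]; rewrite varYM //.
  by rewrite -evNone v.
(* Comparing coefficients in h = (x - c y) z gives z_(i,j) = h_(i+1,j) + c z_(i+1,j-1), unrolled
   here. The equations left over, with no x in the monomial, express the vanishing of [h] on the
   line. *)
pose z i j := \sum_(k < j.+1) c ^+ k * h (i + k).+1 (j - k)%N.
have cz : convergent z.
  have /convergentP[A [B [A0 B0 hh]]] := coefP h.
  have c1 : 0 < 1 + `|c| by rewrite ltr_pwDl.
  apply/convergentP; exists (A * B), (B * (1 + `|c|)); split.
  - by rewrite mulr_ge0 // ltW.
  - exact: mulr_gt0.
  move=> i j; apply: le_trans (ler_norm_sum _ _ _) _.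
  apply: (@le_trans _ _ (A * B ^+ (i + j).+1 * \sum_(k < j.+1) `|c| ^+ k)).
    rewrite mulr_sumr; apply: ler_sum => k _.
    rewrite normrM normrX mulrC ler_wpM2r ?exprn_ge0 //.
    apply: le_trans (hh _ _) _; rewrite addSn -addnA subnKC ?lexx // -ltnS.
    exact: ltn_ord.
  apply: le_trans (ler_wpM2l _ (sum_expr_le _ _)) _ => //.
    by rewrite mulr_ge0 // exprn_ge0 // ltW.
  rewrite exprS exprMn !mulrA ler_wpM2l // ?mulr_ge0 ?exprn_ge0 // ?(ltW B0) //.
  by rewrite exprD ler_peMl ?exprn_ge0 ?(ltW c1) // exprn_ege1 // lerDl.
exists (Germ _ cz); apply: germP => i j; rewrite lineM_Some /= /z.
case: i => [|i].
  have := v j; rewrite evSome big_ord_recl /= expr0 mulr1 subn0.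
  under eq_bigr do rewrite /bump /= add1n exprS mulrCA.
  case: j => [|j]; first by rewrite big_ord0 addr0 => ->; rewrite mulr0 subr0.
  move/eqP; rewrite addr_eq0 => /eqP ->; rewrite sub0r; congr (- _).
  rewrite -mulr_sumr; congr (_ * _); apply: eq_bigr => k _.
  by rewrite subSS add0n mulrC.
rewrite big_ord_recl /= expr0 mul1r subn0 addn0 -[LHS]addr0 -addrA; congr (_ + _).
case: j => [|j]; first by rewrite big_ord0 mulr0 subr0.
apply/esym/eqP; rewrite subr_eq0; apply/eqP; rewrite mulr_sumr.
apply: eq_bigr => k _; rewrite /bump /= add1n exprS mulrA.
by rewrite addSn addnS subSS.
Qed.

(* Regularity of [line p] modulo [a]: the restriction to the line takes values in a domain. *)
Lemma line_regular_mod p a z w : ~ vanish p a -> line p * z = a * w ->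
  exists w', z = a * w'.
Proof.
move=> na e.
have : vanish p (a * w) by rewrite -e; apply: vanishMl; exact: vanish_line.
case/vanishM => // /line_dvd[w' ew]; exists w'.
apply/eqP; rewrite -subr_eq0; apply/eqP; apply: (@line_regular p).
by rewrite mulrBr e ew mulrCA subrr.
Qed.

End Lines.

(** * Codimension of ideals *)
Section Codim.
Variables (C : fieldType) (V : lmodType C).
Implicit Types (J : set V) (d : nat).

Definition lin_closed J := J 0 /\ forall c h k, J h -> J k -> J (c *: h + k).

Lemma lin_closedB J h k : lin_closed J -> J h -> J k -> J (h - k).
Proof. by move=> [_ lJ] Jh Jk; rewrite addrC -scaleN1r; apply: lJ. Qed.

Lemma lin_closedD J h k : lin_closed J -> J h -> J k -> J (h + k).
Proof. by move=> [_ lJ] Jh Jk; rewrite -[h]scale1r; apply: lJ. Qed.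

Lemma lin_closedZ J c h : lin_closed J -> J h -> J (c *: h).
Proof. by move=> [J0 lJ] Jh; rewrite -[_ *: _]addr0; apply: lJ. Qed.

Lemma codim_intro J d (e : 'I_d -> V) : lin_closed J ->
  (forall h, exists c : 'I_d -> C, J (h - \sum_k c k *: e k)) ->
  (forall c : 'I_d -> C, J (\sum_k c k *: e k) -> forall k, c k = 0) ->
  codim_is J d.
Proof.
move=> lJ span free; exists e => h; have [c hc] := span h.
exists (\row_k c k); split=> [|c' hc'].
  by under eq_bigr do rewrite mxE.
apply/rowP => k; rewrite mxE; apply/eqP; rewrite -subr_eq0; apply/eqP.
apply: (free (fun k => c k - c' 0 k)).
have -> : \sum_k (c k - c' 0 k) *: e k =
    (h - \sum_k c' 0 k *: e k) - (h - \sum_k c k *: e k).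
  rewrite opprB addrC addrA subrK -sumrB; by apply: eq_bigr => i _; rewrite scalerBl.
exact: lin_closedB.
Qed.

(** Replaces a basis of the quotient by a coordinate map with kernel [J], which makes matrix rank
    available. *)
Lemma codimP J d : lin_closed J -> codim_is J d <->
  exists phi : {linear V -> 'rV[C]_d},
    (forall v, exists h, phi h = v) /\ (forall h, J h <-> phi h = 0).
Proof.
move=> lJ; split=> [[e he]|[phi [surj ker]]].
  have /choice[phi hphi] : forall h, exists c : 'rV[C]_d, J (h - \sum_k c 0 k *: e k).
    by move=> h; have [c [Jc _]] := he h; exists c.
  have uniq h (c : 'rV[C]_d) : J (h - \sum_k c 0 k *: e k) -> phi h = c.
    by move=> Jc; have [c' [_ u]] := he h; rewrite -(u _ Jc) -(u _ (hphi h)).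
  have lin : linear phi.
    move=> c h k; apply: uniq.
    have -> : \sum_i (c *: phi h + phi k) 0 i *: e i =
        c *: (\sum_i phi h 0 i *: e i) + \sum_i phi k 0 i *: e i.
      rewrite scaler_sumr -big_split; apply: eq_bigr => i _.
      by rewrite !mxE scalerDl scalerA.
    rewrite opprD addrACA -scalerBr.
    by apply: lJ.2.
  pose L : {linear V -> 'rV[C]_d} := HB.pack phi (GRing.isLinear.Build _ _ _ _ phi lin).
  exists L; split=> [v|h].
    exists (\sum_k v 0 k *: e k); apply: uniq; rewrite subrr; exact: lJ.1.
  split=> [Jh|h0].
    by apply: uniq; rewrite big1 ?subr0 // => i _; rewrite mxE scale0r.
  have := hphi h; rewrite -[phi]/(L : _ -> _) h0 big1 ?subr0 // => i _.
  by rewrite mxE scale0r.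
have /choice[e he] : forall k : 'I_d, exists h, phi h = delta_mx 0 k by move=> k.
have phiS (c : 'I_d -> C) : phi (\sum_k c k *: e k) = \row_k c k.
  rewrite linear_sum [RHS]row_sum_delta; apply: eq_bigr => k _.
  by rewrite linearZ /= he mxE.
apply: (@codim_intro _ _ e) => // [h|c].
  exists (fun k => phi h 0 k); apply/ker; rewrite linearB /= phiS.
  by apply/eqP; rewrite subr_eq0; apply/eqP/rowP => k; rewrite mxE.
by move/ker; rewrite phiS => /rowP r k; have := r k; rewrite !mxE.
Qed.

(** The coordinates of the smaller quotient factor through those of the larger one by a matrix [A],
    and surjectivity bounds [d'] by its rank. *)
Lemma codim_le J J' d d' : lin_closed J -> lin_closed J' ->
  (forall h, J h -> J' h) -> codim_is J d -> codim_is J' d' -> (d' <= d)%N.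
Proof.
move=> lJ lJ' JJ' /(codimP _ lJ)[phi [surj ker]] /(codimP _ lJ')[psi [surj' ker']].
have /choice[e he] : forall k : 'I_d, exists h, phi h = delta_mx 0 k by move=> k.
pose A : 'M[C]_(d, d') := \matrix_k psi (e k).
have psiE h : psi h = phi h *m A.
  have : J (h - \sum_k phi h 0 k *: e k).
    apply/ker; rewrite linearB linear_sum /= {1}[phi h]row_sum_delta.
    by apply/eqP; rewrite subr_eq0; apply/eqP/eq_bigr => k _; rewrite linearZ /= he.
  move/JJ'/ker'; rewrite linearB linear_sum /= => /eqP.
  rewrite subr_eq0 => /eqP ->; rewrite mulmx_sum_row.
  by apply: eq_bigr => k _; rewrite linearZ /= rowK.
have : (1%:M <= A)%MS.
  apply/row_subP => i; have [h hE] := surj' (row i 1%:M).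
  by rewrite -hE psiE submxMl.
move/mxrankS; rewrite mxrank1 => /leq_trans; apply; exact: rank_leq_row.
Qed.

Lemma codim_uniq J d d' : lin_closed J -> codim_is J d -> codim_is J d' -> d = d'.
Proof. by move=> lJ h h'; apply/eqP; rewrite eqn_leq !(@codim_le J J). Qed.

(** The image of [J'] in the coordinates of V / J is found as a row space of maximal rank among
    those with preimage inside [J']; its cokernel provides coordinates on V / J'. This gives
    finiteness of Milnor numbers that are not yet computed. *)
Lemma codim_ex J J' d : lin_closed J -> lin_closed J' ->
  (forall h, J h -> J' h) -> codim_is J d -> exists d', codim_is J' d'.
Proof.
move=> lJ lJ' JJ' /(codimP _ lJ)[phi [surj ker]].
pose good (B : 'M[C]_d) := forall h, (phi h <= B)%MS -> J' h.
have ex : exists r, `[< exists B, good B /\ \rank B = r >].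
  exists 0%N; apply/asboolP; exists 0; split; last exact: mxrank0.
  by move=> h; rewrite submx0 => /eqP /ker /JJ'.
have bd r : `[< exists B, good B /\ \rank B = r >] -> (r <= d)%N.
  by move/asboolP => [B [_ <-]]; apply: rank_leq_row.
case: (ex_maxnP ex bd) => r /asboolP[B [gB rB]] maxB.
have BE h : J' h <-> (phi h <= B)%MS.
  split=> [J'h|]; last exact: gB.
  have gB' : good (B + phi h)%MS.
    move=> k /sub_addsmxP[[u v] /= ku].
    have [w hw] := surj (u *m B).
    have kE : phi (k - (w + v 0 0 *: h)) = 0.
      rewrite linearB linearD linearZ /= hw ku.
      by rewrite {1}(mx11_scalar v) mul_scalar_mx subrr.
    have J'w : J' w by apply: gB; rewrite hw submxMl.
    have := lin_closedD lJ' (JJ' _ ((ker _).2 kE)) (lin_closedD lJ' J'w (lin_closedZ (v 0 0) lJ' J'h)).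
    by rewrite subrK.
  have : (\rank (B + phi h)%MS <= \rank B)%N.
    by rewrite rB; apply: maxB; apply/asboolP; exists (B + phi h)%MS.
  have BS := addsmxSl B (phi h).
  rewrite (geq_leqif (mxrank_leqif_eq BS)) => /andP[_ le].
  by apply: submx_trans le; apply: addsmxSr.
pose K := cokermx B.
exists (\rank K); apply/codimP => //.
pose psi h : 'rV[C]_(\rank K) := phi h *m col_base K.
have lin : linear psi by move=> c h k; rewrite /psi linearP /= mulmxDl scalemxAl.
pose L : {linear V -> 'rV[C]_(\rank K)} :=
  HB.pack psi (GRing.isLinear.Build _ _ _ _ psi lin).
exists L; split=> /= [v|h].
  have /row_fullP[D hD] := col_base_full K.
  have [h hh] := surj (v *m D); exists h.
  by rewrite /psi hh -mulmxA hD mulmx1.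
apply: (iff_trans (BE h)); rewrite submxE -[cokermx B]/K -{1}[K]mulmx_base mulmxA.
split=> [/eqP e|]; last by rewrite /psi => ->; rewrite mul0mx.
apply: (row_free_inj (row_base_free K)).
by rewrite e mul0mx.
Qed.

End Codim.

Section Ideals.
Variable C : numFieldType.
Implicit Types (f g h a b c z : germ C) (p q : option C).

Definition ideal2 a b : set (germ C) := fun h => exists u v, h = u * a + v * b.

Lemma ideal2_closed a b : lin_closed (ideal2 a b).
Proof.
split; first by exists 0, 0; rewrite !mul0r addr0.
move=> c _ _ [u [v ->]] [u' [v' ->]]; exists (c *: u + u'), (c *: v + v').
by rewrite !mulrDl scalerDr !scalerAl addrACA.
Qed.

Lemma ideal2M a b h k : ideal2 a b h -> ideal2 a b (k * h).
Proof. by move=> [u [v ->]]; exists (k * u), (k * v); rewrite mulrDr !mulrA. Qed.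

Lemma codim_ext (J J' : set (germ C)) d : (forall h, J h <-> J' h) ->
  codim_is J d -> codim_is J' d.
Proof.
move=> JJ' [e he]; exists e => h; have [c [Jc u]] := he h.
by exists c; split=> [|c' /JJ']; [apply/JJ' | exact: u].
Qed.

(** Multiplication by [b] gives an exact sequence 0 -> O/(a,c) -> O/(a,bc) -> O/(a,b) -> 0; the
    hypothesis that [b] is regular modulo [a] is its injectivity on the left. *)
Lemma codim_ideal2_mul a b c d1 d2 : (forall z w, b * z = a * w -> exists w', z = a * w') ->
  codim_is (ideal2 a b) d1 -> codim_is (ideal2 a c) d2 ->
  codim_is (ideal2 a (b * c)) (d1 + d2).
Proof.
move=> reg h1 h2; have lin := ideal2_closed.
have free J d (e : 'I_d -> germ C) : lin_closed J ->
    (forall h, exists! c : 'rV[C]_d, J (h - \sum_k c 0 k *: e k)) ->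
    forall c : 'I_d -> C, J (\sum_k c k *: e k) -> forall k, c k = 0.
  move=> lJ he cc Jc k; have [x [_ u]] := he (\sum_k cc k *: e k).
  have r0 : \sum_k (0 : 'rV[C]_d) 0 k *: e k = 0.
    by rewrite big1 // => i _; rewrite mxE scale0r.
  have := u 0; rewrite r0 subr0 => /(_ Jc) x0.
  have rE : \sum_k (\row_i cc i) 0 k *: e k = \sum_k cc k *: e k.
    by apply: eq_bigr => i _; rewrite mxE.
  have := u (\row_k cc k); rewrite rE subrr => /(_ lJ.1) x1.
  by move: x1; rewrite x0 => /rowP/(_ k); rewrite !mxE.
case: h1 h2 => e1 he1 [e2 he2].
pose e k := match split k with inl k => e1 k | inr k => b * e2 k end.
have eS (x : 'I_(d1 + d2) -> C) : \sum_k x k *: e k =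
    \sum_k x (lshift d2 k) *: e1 k + b * \sum_k x (rshift d1 k) *: e2 k.
  rewrite big_split_ord /= mulr_sumr; congr (_ + _); apply: eq_bigr => k _.
    by rewrite /e (unsplitK (inl k)).
  by rewrite /e (unsplitK (inr k)) germ_scalerAr.
apply: (@codim_intro _ _ _ _ e) => // [h|x].
  have [x [[u [v hx]] _]] := he1 h; have [y [[u' [v' hy]] _]] := he2 v.
  pose xy k := match split k with inl k => x 0 k | inr k => y 0 k end.
  have xyl : \sum_k xy (lshift d2 k) *: e1 k = \sum_k x 0 k *: e1 k.
    by apply: eq_bigr => k _; rewrite /xy (unsplitK (inl k)).
  have xyr : \sum_k xy (rshift d1 k) *: e2 k = \sum_k y 0 k *: e2 k.
    by apply: eq_bigr => k _; rewrite /xy (unsplitK (inr k)).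
  exists xy; rewrite eS xyl xyr.
  exists (u + b * u'), v'; rewrite opprD addrA hx.
  move/eqP: hy; rewrite subr_eq => /eqP ->.
  ring.
rewrite eS => Jx.
have x1 k : x (lshift d2 k) = 0.
  apply: (free _ _ _ (lin a b) he1 (fun k => x (lshift d2 k))).
  case: Jx => u [v /eqP]; rewrite -subr_eq => /eqP Jx.
  exists u, (v * c - \sum_k x (rshift d1 k) *: e2 k).
  by rewrite -{1}Jx; ring.
have x2 k : x (rshift d1 k) = 0.
  apply: (free _ _ _ (lin a c) he2 (fun k => x (rshift d1 k))).
  case: Jx => u [v]; rewrite big1 => [|i _]; last by rewrite x1 scale0r.
  rewrite add0r => Jx.
  have [|w' hw] := reg (\sum_k x (rshift d1 k) *: e2 k - v * c) u.
    by rewrite mulrBr Jx; ring.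
  by exists w', v; rewrite mulrC -hw subrK.
by move=> k; case: (splitP k) => i ik; [rewrite -(x1 i)|rewrite -(x2 i)];
   congr x; apply: val_inj.
Qed.

End Ideals.

(** * Division in one variable and intersection numbers with unions of lines *)

Section OneVariable.
Variable C : numFieldType.
Implicit Types (f g h a b c z : germ C) (p q : option C).

(** Course-of-values recursion for the coefficients of a quotient. The table [U n] is right only at
    indices below [n]; its other entries get overwritten. *)
Lemma course_rec (v : nat -> C) (b : nat -> nat -> C) :
  exists u : nat -> C, forall d, u d = v d - \sum_(i < d) b d i * u i.
Proof.
pose step n (w : nat -> C) i :=
  if (i < n)%N then w i else v n - \sum_(k < n) b n k * w k.
pose U := fix U n := if n is n'.+1 then step n' (U n') else fun=> 0.
have US n i : (i < n)%N -> U n i = U i.+1 i.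
  elim: n => // n IH; rewrite ltnS leq_eqVlt => /predU1P[->//|lin].
  by rewrite [LHS]/= /step lin IH.
exists (fun d => U d.+1 d) => d; rewrite [LHS]/= /step ltnn; congr (_ - _).
by apply: eq_bigr => i _; rewrite US.
Qed.

Lemma ev_bound p f : exists A B, [/\ 0 <= A, 0 < B & forall d, `|ev p f d| <= A * B ^+ d].
Proof.
have /convergentP[A [B [A0 B0 hf]]] := coefP f.
case: p => [c|]; last first.
  by exists A, B; split=> // d; rewrite evNone -{2}[d]addn0.
have c1 : 0 < 1 + `|c| by rewrite ltr_pwDl.
exists A, (B * (1 + `|c|)); split=> // [|d]; first exact: mulr_gt0.
rewrite evSome; apply: le_trans (ler_norm_sum _ _ _) _.
apply: (@le_trans _ _ (\sum_(i < d.+1) A * B ^+ d * `|c| ^+ i)).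
  apply: ler_sum => i _; rewrite normrM normrX ler_wpM2r ?exprn_ge0 //.
  by apply: le_trans (hf _ _) _; rewrite subnKC // -ltnS.
rewrite -mulr_sumr exprMn mulrA ler_wpM2l ?sum_expr_le //.
by rewrite mulr_ge0 // exprn_ge0 // ltW.
Qed.

(** A series in the coordinate that restricts to the parameter of the line: y for [Some _], x for
    [None]. *)
Definition uni_coef p (u : nat -> C) (i j : nat) : C :=
  if p is Some _ then (if i == 0%N then u j else 0) else (if j == 0%N then u i else 0).

Lemma uni_convergent p u (A B : C) : 0 <= A -> 0 < B ->
  (forall d, `|u d| <= A * B ^+ d) -> convergent (uni_coef p u).
Proof.
move=> A0 B0 hu; apply/convergentP; exists A, B; split=> // i j.
have AB : 0 <= A * B ^+ (i + j) by rewrite mulr_ge0 // exprn_ge0 // ltW.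
by case: p => [c|] /=; case: eqP => [->|_]; rewrite ?normr0 // ?add0n ?addn0.
Qed.

Lemma ev_uni p u d : ev p (uni_coef p u) d = u d.
Proof.
case: p => [c|]; last by rewrite evNone.
rewrite evSome big_ord_recl /= subn0 expr0 mulr1 big1 ?addr0 // => i _.
by rewrite mul0r.
Qed.

(* Division in one variable, with the geometric bound
   |u d| <= S B^d (1 + S)^d propagated through the recursion. *)
Lemma ev_divide p a h k :
  (forall i, (i < k)%N -> ev p a i = 0) -> ev p a k != 0 ->
  (forall i, (i < k)%N -> ev p h i = 0) ->
  exists u, convergent (uni_coef p u) /\
    forall v : germ C, coef v = uni_coef p u -> vanish p (h - a * v).
Proof.
move=> alow ak hlow; pose al := ev p a k.
have [u hu] := course_rec (fun d => al^-1 * ev p h (k + d)%N)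
  (fun d i => al^-1 * ev p a (k + d - i)%N).
exists u; split; last first.
  move=> v ve d; rewrite evD evN evM.
  have vE i : ev p v i = u i by rewrite ve ev_uni.
  case: (ltnP d k) => [dk|kd].
    rewrite hlow // big1 ?subr0 // => i _.
    by rewrite alow ?mul0r // (leq_trans (ltn_ord i)).
  rewrite -(subnKC kd); move: (d - k)%N => {kd}d.
  (* Reversing the sum indexes it by the coefficients of [u]: those beyond [d] meet vanishing
     coefficients of [a], and the one at [d] is what the recursion solves for. *)
  rewrite (reindex_inj rev_ord_inj) /=.
  have E (i : 'I_(k + d).+1) :
      ev p a ((k + d).+1 - i.+1)%N * ev p v (k + d - ((k + d).+1 - i.+1))%N
      = ev p a (k + d - i)%N * u i.
    by rewrite subSS subKn ?vE // -ltnS.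
  under eq_bigr do rewrite E.
  rewrite -(big_mkord xpredT (fun i => ev p a (k + d - i)%N * u i)).
  rewrite (@big_cat_nat _ _ _ d.+1) //=; last by lia.
  rewrite [X in _ - (_ + X)]big_nat [X in _ - (_ + X)]big1 ?addr0; last first.
    by move=> i /andP[di ik]; rewrite alow ?mul0r //; lia.
  rewrite big_nat_recr //= big_mkord addnK hu mulrBr mulVKf // mulr_sumr.
  have -> : \sum_(i < d) ev p a k * (al^-1 * ev p a (k + d - i) * u i) =
      \sum_(i < d) ev p a (k + d - i) * u i.
    by apply: eq_bigr => i _; rewrite -mulrA mulVKf.
  ring.
have [A [B [A0 B0 hA]]] := ev_bound p a; have [A' [B' [A'0 B'0 hA']]] := ev_bound p h.
pose D := B + B'; have D0 : 0 < D by rewrite addr_gt0.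
(* [S] absorbs the inverse leading coefficient, both constants and the shift by [k], so that [bh]
   and [ba] share one bound. *)
pose S := `|al^-1| * (A + A') * D ^+ k.
have S0 : 0 <= S.
  by rewrite mulr_ge0 ?exprn_ge0 ?(ltW D0) // mulr_ge0 // addr_ge0.
have BD n : B ^+ n <= D ^+ n by rewrite lerXn2r ?nnegrE ?(ltW B0) ?(ltW D0) // lerDl ltW.
have B'D n : B' ^+ n <= D ^+ n by rewrite lerXn2r ?nnegrE ?(ltW B'0) ?(ltW D0) // lerDr ltW.
have bnd (A1 x B1 : C) n : 0 <= A1 -> A1 <= A + A' -> 0 < B1 -> B1 ^+ (k + n) <= D ^+ (k + n) ->
    `|x| <= A1 * B1 ^+ (k + n) -> `|al^-1 * x| <= S * D ^+ n.
  move=> A10 A1A B10 B1D hx; rewrite normrM /S -!mulrA ler_wpM2l // -exprD.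
  apply: le_trans hx _; apply: ler_pM => //; by rewrite exprn_ge0 // ltW.
have bh d : `|al^-1 * ev p h (k + d)%N| <= S * D ^+ d.
  by apply: (bnd A' _ B') => //; rewrite lerDr.
have ba d : `|al^-1 * ev p a (k + d)%N| <= S * D ^+ d.
  by apply: (bnd A _ B) => //; rewrite lerDl.
have S1 : 0 < 1 + S by rewrite ltr_pwDl.
apply: (@uni_convergent _ _ S (D * (1 + S))) => //; first exact: mulr_gt0.
have geo n : 1 + \sum_(i < n) S * (1 + S) ^+ i = (1 + S) ^+ n.
  elim: n => [|n IH]; first by rewrite big_ord0 addr0.
  by rewrite big_ord_recr /= addrA IH exprS; ring.
move=> d; elim/ltn_ind: d => d IH; rewrite hu.
apply: le_trans (ler_normB _ _) _.
apply: (@le_trans _ _ (S * D ^+ d * (1 + \sum_(i < d) S * (1 + S) ^+ i))); last first.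
  by rewrite geo exprMn mulrA.
rewrite mulrDr mulr1 lerD //; apply: le_trans (ler_norm_sum _ _ _) _.
rewrite mulr_sumr; apply: ler_sum => i _; have id := ltn_ord i.
rewrite normrM -addnBA 1?ltnW //.
apply: (@le_trans _ _ (S * D ^+ (d - i) * (S * (D * (1 + S)) ^+ i))).
  by apply: ler_pM => //; exact: IH.
have -> : D ^+ d = D ^+ (d - i) * D ^+ i by rewrite -exprD subnK // ltnW.
by rewrite exprMn le_eqVlt; apply/orP; left; apply/eqP; ring.
Qed.

Definition param p k : germ C := if p is Some _ then germ_mono C 0 k else germ_mono C k 0.

Lemma ev_param p k d : ev p (param p k) d = (d == k)%:R.
Proof.
case: p => [c|]; last by rewrite evNone /= /ser_mono eqxx andbT.
rewrite evSome big_ord_recl /= /ser_mono subn0 expr0 mulr1 eqxx andTb.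
by rewrite big1 ?addr0 // => i _; rewrite /= mul0r.
Qed.

(** Modulo the line the ring is that of convergent series in t, where [a] becomes t^k times a unit;
    the basis is 1, t, ..., t^(k-1). *)
Lemma codim_line a p k : (forall i, (i < k)%N -> ev p a i = 0) -> ev p a k != 0 ->
  codim_is (ideal2 a (line p)) k.
Proof.
move=> alow ak; apply: (@codim_intro _ _ _ _ (fun i : 'I_k => param p i)).
- exact: ideal2_closed.
- move=> h; exists (fun i => ev p h i).
  have evS d : ev p (\sum_(i < k) ev p h i *: param p i) d = if (d < k)%N then ev p h d else 0.
    rewrite ev_sum; case: ltnP => dk.
      rewrite (bigD1 (Ordinal dk)) //= evZ ev_param eqxx mulr1 big1 ?addr0 // => i id.
      rewrite evZ ev_param (_ : (d == i)%N = false) ?mulr0 //.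
      by apply: contraNF id => /eqP e; apply/eqP/val_inj.
    rewrite big1 // => i _; rewrite evZ ev_param gtn_eqF ?mulr0 //.
    exact: leq_trans (ltn_ord i) dk.
  set h' := h - _; have [i ik|u [cu hu]] := @ev_divide p a h' k alow ak.
    by rewrite evD evN evS ik subrr.
  have [w hw] := line_dvd (hu (Germ _ cu) erefl).
  exists (Germ _ cu), w; rewrite [w * _]mulrC -hw; ring.
- move=> c [u [v e]] i.
  have := congr1 (fun f : germ C => ev p f i) e.
  rewrite evD [X in _ + X]evM [X in _ + X]big1 => [|l _]; last by rewrite vanish_line mulr0.
  rewrite addr0 evM [RHS]big1 => [|l _]; last first.
    by rewrite alow ?mulr0 // (leq_ltn_trans (leq_subr _ _)).
  rewrite ev_sum (bigD1 i) //= evZ ev_param eqxx mulr1 big1 ?addr0 // => l li.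
  rewrite evZ ev_param (_ : (i == l :> nat) = false) ?mulr0 //.
  by apply: contraNF li => /eqP el; apply/eqP/val_inj.
Qed.

Lemma lines_regular_mod a (s : seq (option C)) z w : (forall p, p \in s -> ~ vanish p a) ->
  (\prod_(p <- s) line p) * z = a * w -> exists w', z = a * w'.
Proof.
elim: s z w => [|p s IH] z w na; first by rewrite big_nil mul1r; exists w.
rewrite big_cons -mulrA => /line_regular_mod[|w' /IH]; first by apply: na; rewrite mem_head.
by apply=> q qs; apply: na; rewrite in_cons qs orbT.
Qed.

(** Additivity reduces this to a single line; the regularity it requires holds because [a] vanishes
    on no line of [s]. Repetitions in [s] are allowed. *)
Lemma codim_lines a (s : seq (option C)) (k : option C -> nat) (c : C) : c != 0 ->
  (forall p, p \in s -> (forall i, (i < k p)%N -> ev p a i = 0) /\ ev p a (k p) != 0) ->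
  codim_is (ideal2 a (c *: \prod_(p <- s) line p)) (\sum_(p <- s) k p)%N.
Proof.
move=> c0 hs.
suff: codim_is (ideal2 a (\prod_(p <- s) line p)) (\sum_(p <- s) k p)%N.
  apply: codim_ext => h; split=> -[u [v ->]].
    by exists u, (c^-1 *: v); rewrite -scalerAl -germ_scalerAr scalerA mulVf ?scale1r.
  by exists u, (c *: v); rewrite -scalerAl germ_scalerAr.
elim: s hs => [|p s IH] hs.
  rewrite !big_nil; apply: (@codim_intro _ _ _ _ (fun=> 0)) => [|h|_ _ []//].
    exact: ideal2_closed.
  by exists (fun=> 0), 0, h; rewrite big_ord0 subr0 mul0r add0r mulr1.
have [plow pk] := hs p (mem_head _ _).
rewrite !big_cons; apply: codim_ideal2_mul.
- by move=> z w; apply: line_regular_mod => v; rewrite v eqxx in pk.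
- exact: codim_line.
- by apply: IH => q qs; apply: hs; rewrite in_cons qs orbT.
Qed.

End OneVariable.

(** * Homogeneous germs *)
Section Homogeneous.
Variable C : numFieldType.
Implicit Types (f g h a b c z : germ C) (p q : option C) (d e : nat).

Definition homog d f := forall i j, (i + j)%N != d -> f i j = 0.

Lemma homogD d f g : homog d f -> homog d g -> homog d (f + g).
Proof. by move=> hf hg i j ij; rewrite germ_coefD hf ?hg ?addr0. Qed.

Lemma homogZ d (c : C) f : homog d f -> homog d (c *: f).
Proof. by move=> hf i j ij; rewrite germ_coefZ hf ?mulr0. Qed.

Lemma homogN d f : homog d f -> homog d (- f).
Proof. by rewrite -scaleN1r; apply: homogZ. Qed.

Lemma homogM d e f g : homog d f -> homog e g -> homog (d + e) (f * g).
Proof.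
move=> hf hg i j ij; rewrite germ_coefM big1 // => k _; rewrite big1 // => l _.
have := ltn_ord k; have := ltn_ord l; rewrite !ltnS => lj ki.
case: (eqVneq (k + l)%N d) => kl; last by rewrite hf ?mul0r.
by rewrite hg ?mulr0 //; apply: contraNneq ij; lia.
Qed.

Lemma homog_varX : homog 1 (varX : germ C).
Proof.
by move=> [|[|i]] [|[|j]]; rewrite /= /ser_mono.
Qed.

Lemma homog_varY : homog 1 (varY : germ C).
Proof.
by move=> [|[|i]] [|[|j]]; rewrite /= /ser_mono.
Qed.

Lemma homog_line p : homog 1 (line p).
Proof.
case: p => [c|]; last exact: homog_varY.
apply: homogD; first exact: homog_varX.
by apply: homogN; apply: homogZ; apply: homog_varY.
Qed.

Lemma homog1 : homog 0 (1 : germ C).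
Proof. by move=> [|i] [|j] //; rewrite germ_coef1. Qed.

Lemma homog_lines (s : seq (option C)) : homog (size s) (\prod_(p <- s) line p).
Proof.
elim: s => [|p s IH]; first by rewrite big_nil; apply: homog1.
by rewrite big_cons -[size _]add1n; apply: homogM => //; apply: homog_line.
Qed.

Lemma homog_exp d f k : homog d f -> homog (k * d) (f ^+ k).
Proof.
move=> hf; elim: k => [|k IH]; first exact: homog1.
by rewrite exprS mulSn; apply: homogM.
Qed.

Lemma homog_dx d f : homog d.+1 f -> homog d (dx f).
Proof. by move=> hf i j ij; rewrite dxE hf ?mul0rn // addSn eqSS. Qed.

Lemma homog_dy d f : homog d.+1 f -> homog d (dy f).
Proof. by move=> hf i j ij; rewrite dyE hf ?mul0rn // addnS eqSS. Qed.

Lemma ev_homog p d f e : homog d f -> e != d -> ev p f e = 0.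
Proof.
move=> hf ed; rewrite /ev big1 // => i _; rewrite hf ?mul0r // subnKC //.
by rewrite -ltnS.
Qed.

Lemma vanish_homog p d f : homog d f -> ev p f d = 0 -> vanish p f.
Proof. by move=> hf f0 e; case: (eqVneq e d) => [->|/ev_homog->]. Qed.

Lemma ev_homogM p e f g d : homog e f -> ev p (f * g) (e + d) = ev p f e * ev p g d.
Proof.
move=> hf; rewrite evM.
have le : (e < (e + d).+1)%N by rewrite ltnS leq_addr.
rewrite (bigD1 (Ordinal le)) //= addKn big1 ?addr0 // => i ie.
by rewrite (ev_homog _ hf) ?mul0r //; apply: contra ie => /eqP ei; apply/eqP/val_inj.
Qed.

Lemma euler d f : homog d f -> varX * dx f + varY * dy f = d%:R *: f.
Proof.
move=> hf; apply: germP => i j; rewrite germ_coefD germ_coefZ varXM varYM.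
have [ij|ij] := eqVneq (i + j)%N d; last first.
  rewrite (hf i j) // mulr0.
  case: i ij => [|i] ij; case: j ij => [|j] ij; rewrite ?dxE ?dyE ?hf ?mul0rn ?addr0 //.
by rewrite -ij mulr_natl mulrnDr; case: i {ij} => [|i]; case: j => [|j];
  rewrite ?dxE ?dyE ?mulr0n.
Qed.

(** [tang p] differentiates along the line [p], and [der p] transversally to it, normalised to be 1
    on [line p]. The two generate the same ideal as the partial derivatives. *)
Definition der p f := if p is Some _ then dx f else dy f.
Definition tang p f := if p is Some c then c *: dx f + dy f else dx f.

Lemma derD p f g : der p (f + g) = der p f + der p g.
Proof. by case: p => [c|]; rewrite /der (dxD, dyD). Qed.
Lemma derZ p (c : C) f : der p (c *: f) = c *: der p f.
Proof. by case: p => [c'|]; rewrite /der (dxZ, dyZ). Qed.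
Lemma derM p f g : der p (f * g) = der p f * g + f * der p g.
Proof. by case: p => [c'|]; rewrite /der (dxM, dyM). Qed.

Lemma tangD p f g : tang p (f + g) = tang p f + tang p g.
Proof. by case: p => [c|]; rewrite /tang ?dxD ?dyD ?scalerDr // addrACA. Qed.
Lemma tangZ p (c : C) f : tang p (c *: f) = c *: tang p f.
Proof.
by case: p => [c'|]; rewrite /tang ?dxZ ?dyZ // scalerDr !scalerA [c' * c]mulrC.
Qed.
Lemma tangM p f g : tang p (f * g) = tang p f * g + f * tang p g.
Proof.
case: p => [c|]; rewrite /tang ?dxM ?dyM // scalerDr scalerAl germ_scalerAr.
ring.
Qed.

Lemma dx_var : (dx varX = 1 :> germ C) * (dx varY = 0 :> germ C) *
  (dy varX = 0 :> germ C) * (dy varY = 1 :> germ C).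
Proof.
do !split; apply: germP => i j; rewrite ?germ_coef0 ?germ_coef1 ?dxE ?dyE /= /ser_mono ?eqSS.
- by case: i => [|i]; rewrite //= mul0rn.
- by rewrite mul0rn.
- by rewrite andbF mul0rn.
- by case: j => [|j]; rewrite ?andbF //= mul0rn.
Qed.

Lemma der_line p : der p (line p) = 1.
Proof.
case: p => [c|]; rewrite /der /line ?dx_var //.
by rewrite dxD -scaleN1r !dxZ !dx_var !scaler0 addr0.
Qed.

Lemma tang_line p : tang p (line p) = 0.
Proof.
case: p => [c|]; rewrite /tang /line ?dx_var //.
by rewrite dxD dyD -scaleN1r !dxZ !dyZ !dx_var !scaler0 addr0 add0r scaleN1r subrr.
Qed.

Lemma tang_line_exp p k : tang p (line p ^+ k) = 0.
Proof.
elim: k => [|k IH]; last by rewrite exprS tangM tang_line IH mul0r mulr0 addr0.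
have := tangM p 1 1; rewrite expr0 !mulr1 mul1r => /eqP.
by rewrite -subr_eq subrr => /eqP.
Qed.

Lemma der_line_exp q p k : der q (line p ^+ k.+1) = k.+1%:R *: (line p ^+ k * der q (line p)).
Proof.
elim: k => [|k IH]; first by rewrite expr1 expr0 mul1r scale1r.
rewrite exprS derM IH exprS -[k.+2%:R]natr1 addrC scalerDl scale1r -germ_scalerAr.
by rewrite -mulrA [der _ _ * _]mulrC -mulrA; congr (_ + _); rewrite mulrA.
Qed.

Lemma homog_der p d f : homog d.+1 f -> homog d (der p f).
Proof. by case: p => [c|]; [apply: homog_dx | apply: homog_dy]. Qed.

Lemma homog_tang p d f : homog d.+1 f -> homog d (tang p f).
Proof.
case: p => [c|] hf; last exact: homog_dx.
by apply: homogD; [apply: homogZ; apply: homog_dx | apply: homog_dy].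
Qed.

(* Euler's identity restricted to the line. *)
Lemma ev_tang p d f : homog d.+1 f -> ev p (tang p f) d = d.+1%:R * ev p f d.+1.
Proof.
move=> hf; rewrite -evZ -(euler hf) evD -[d.+1]add1n.
rewrite (ev_homogM _ _ _ homog_varX) (ev_homogM _ _ _ homog_varY) ev_varX ev_varY eqxx.
case: p => [c|]; rewrite /tang /pt /fst /snd ?evD ?evZ mul1r //.
by rewrite mul0r addr0.
Qed.

Lemma jacobian_tang p f h : jacobian_ideal f h <-> ideal2 (der p f) (tang p f) h.
Proof.
rewrite /jacobian_ideal /ideal2 /=; case: p => [c|] /=; split=> -[u [v ->]].
- exists (u - c *: v), v; rewrite mulrBl mulrDr -germ_scalerAr scalerAl addrA subrK //.
- by exists (u + c *: v), v; rewrite mulrDl mulrDr -germ_scalerAr scalerAl addrA.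
- by exists v, u; rewrite addrC.
- by exists v, u; rewrite addrC.
Qed.

Lemma milnorE p f m : milnor f m <-> codim_is (ideal2 (der p f) (tang p f)) m.
Proof. by split; apply: codim_ext => h; rewrite (jacobian_tang p). Qed.

Lemma milnor_uniq f m m' : milnor f m -> milnor f m' -> m = m'.
Proof.
by move=> /(milnorE None) h /(milnorE None); apply: codim_uniq h; apply: ideal2_closed.
Qed.

Lemma vanish_lines p (s : seq (option C)) : vanish p (\prod_(q <- s) line q) -> p \in s.
Proof.
elim: s => [|q s IH].
  rewrite big_nil => /(_ 0%N)/eqP.
  by rewrite /ev big_ord1 germ_coef1 !expr0 !mulr1 oner_eq0.
rewrite big_cons => /vanishM[v|/IH]; last by rewrite in_cons orbC => ->.
by have /eqP := v 1%N; rewrite ev_line_eq0 in_cons => ->.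
Qed.

Lemma vanishZ p (c : C) f : c != 0 -> vanish p (c *: f) -> vanish p f.
Proof.
by move=> c0 v d; have /eqP := v d; rewrite evZ mulf_eq0 (negPf c0) => /eqP.
Qed.

(** By Euler's identity [p] would be one of the lines of [f]; on that line [der p f] restricts to
    the cofactor, which is non-zero because the line occurs once. *)
Lemma grad_neq0 p (c : C) (s : seq (option C)) f : c != 0 -> uniq s -> (0 < size s)%N ->
  f = c *: \prod_(q <- s) line q -> vanish p (dx f) -> vanish p (dy f) -> False.
Proof.
move=> c0 us s0 fE vx vy.
have hf : homog (size s) f by rewrite fE; apply/homogZ/homog_lines.
have vf : vanish p (\prod_(q <- s) line q).
  apply: (vanishZ c0); rewrite -fE.
  apply: (@vanishZ _ (size s)%:R); first by rewrite pnatr_eq0 -lt0n.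
  rewrite -(euler hf) => d; rewrite evD [varX * _]mulrC [varY * _]mulrC.
  by rewrite (vanishMl _ vx) (vanishMl _ vy) addr0.
have ps := vanish_lines vf.
have vd : vanish p (der p f) by case: (p) vx vy.
have := vd; rewrite fE derZ => /(vanishZ c0); rewrite (big_rem _ ps) /= derM der_line mul1r.
set Q := \prod_(_ <- _) _ => vQ.
have : vanish p Q.
  move=> d; have := vQ d; rewrite evD [X in _ + X](_ : _ = 0) ?addr0 //.
  by apply: vanishMl; apply: vanish_line.
by move/vanish_lines; rewrite mem_rem_uniq // inE eqxx.
Qed.

End Homogeneous.

(** * Factorisation of forms and Milnor numbers over an algebraically closed field *)

Section Closed.
Variable C : numClosedFieldType.
Implicit Types (f g h a b z : germ C) (p q : option C) (d e : nat).

(** Without a pure power of x the line y = 0 is a root; otherwise f(x, 1) has full degree and a root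
    of its own. *)
Lemma homog_root d f : homog d.+1 f -> exists p, ev p f d.+1 = 0.
Proof.
move=> hf; have [f0|f0] := eqVneq (f d.+1 0%N) 0; first by exists None; rewrite evNone.
pose q : {poly C} := \poly_(i < d.+2) f i (d.+1 - i)%N.
have sq : size q = d.+2 by apply: size_poly_eq; rewrite subnn.
have /closed_rootP[c] : size q != 1%N by rewrite sq.
by rewrite /root horner_poly => /eqP qc; exists (Some c); rewrite evSome.
Qed.

Lemma homog_line_cancel p d z : homog d.+1 (line p * z) -> homog d z.
Proof.
(* [P] is the part of degree [d] of [z]; the line times [z - P] is 0, hence so is [z - P]. *)
move=> hz; pose P i j := if (i + j == d)%N then z i j else 0.
have cP : convergent P.
  apply: (@convergent_dom _ z _ 0 0 1) => // [|i j]; first exact: coefP.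
  by rewrite expr1n mulr1 !addn0 /P; case: eqP; rewrite ?normr0.
suff: z - Germ _ cP = 0.
  move/eqP; rewrite subr_eq0 => /eqP -> i j ij.
  by rewrite /= /P (negPf ij).
apply: (@line_regular _ p); apply: germP => i j; rewrite germ_coef0 mulrBr germ_coefB.
have [ij|ij] := eqVneq (i + j)%N d.+1.
  case: p {hz} => [c|]; rewrite ?lineM_Some ?varYM.
    have E k l : (k + l).+1 = d.+1 -> P k l = z k l by move=> [kl]; rewrite /P kl eqxx.
    case: i ij => [|i]; case: j => [|j] //= ij; rewrite ?E ?subrr //; lia.
  by case: j ij => [|j] ij /=; rewrite ?subrr // /P -eqSS -addnS ij eqxx subrr.
rewrite hz // sub0r; apply/eqP; rewrite oppr_eq0; apply/eqP.
have hP : homog d (Germ _ cP) by move=> k l /negPf kl; rewrite /= /P kl.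
by apply: (homogM (@homog_line _ p) hP); rewrite add1n.
Qed.

Lemma homog_factor d f : homog d f -> f <> 0 -> exists c (s : seq (option C)),
  [/\ c != 0, size s = d & f = c *: \prod_(p <- s) line p].
Proof.
elim: d f => [|d IH] f hf f0.
  have fE : f = f 0%N 0%N *: 1.
    apply: germP => i j; rewrite germ_coefZ germ_coef1 mulr_natr.
    have [/eqP|ij] := eqVneq (i + j)%N 0%N; last first.
      by rewrite hf //; move: ij; rewrite addn_eq0 => /negPf ->.
    by rewrite addn_eq0 => /andP[/eqP -> /eqP ->].
  exists (f 0%N 0%N), [::]; split; rewrite ?big_nil //.
  by apply/eqP => e; apply: f0; rewrite fE e scale0r.
have [p /(vanish_homog hf)/line_dvd[z fE]] := homog_root hf.
have [||c [s [c0 ss zE]]] := IH z.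
- by apply: (@homog_line_cancel p); rewrite -fE.
- by move=> z0; apply: f0; rewrite fE z0 mulr0.
- exists c, (p :: s); split=> //=; first by rewrite ss.
  by rewrite big_cons germ_scalerAr -zE.
Qed.

(** [dy f] splits into [(size s).-1] lines; by [grad_neq0] none of them kills [dx f], so each
    contributes the degree of [dx f]. *)
Lemma milnor_homog f (c : C) (s : seq (option C)) : c != 0 -> uniq s -> (1 < size s)%N ->
  f = c *: \prod_(q <- s) line q -> milnor f ((size s).-1 * (size s).-1).
Proof.
move=> c0 us s1 fE; have s0 : (0 < size s)%N by apply: ltnW.
have grad := grad_neq0 c0 us s0 fE.
have hf : homog (size s).-1.+1 f by rewrite prednK // fE; apply/homogZ/homog_lines.
have hx := homog_dx hf; have hy := homog_dy hf.
have y0 : dy f <> 0.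
  move=> y0; have hx' := hx; rewrite -(prednK (_ : 0 < (size s).-1)%N) in hx'; last by lia.
  have [p /(vanish_homog hx') vx] := homog_root hx'.
  by apply: (grad p) => // d; rewrite y0 ev0.
have [c' [s' [c'0 ss' yE]]] := homog_factor hy y0.
have := @codim_lines _ (dx f) s' (fun=> (size s).-1) c' c'0.
rewrite -yE big_const_seq count_predT iter_addn_0 ss'; apply=> p ps.
split=> [i is_|]; first by rewrite (ev_homog _ hx) // ltn_eqF.
apply/eqP => /(vanish_homog hx) vx; apply: (grad p) => // d.
by rewrite yE (big_rem _ ps) evZ /= vanishMl ?mulr0 //; apply: vanish_line.
Qed.

(* With [f = line p * Q], differentiating [f + t * line p ^ k] along [line p] gives
   the homogeneous form [line p * tang p Q], independent of [t]. *)
Lemma milnor_deform f (c t : C) p (s : seq (option C)) k : c != 0 -> t != 0 ->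
  uniq (p :: s) -> (0 < k)%N -> (k < size s)%N ->
  f = c *: \prod_(q <- p :: s) line q ->
  milnor (f + t *: line p ^+ k.+1) (size s + (size s).-1 * k).
Proof.
move=> c0 t0 /= /andP[ps us] k0 ks fE.
pose Q := c *: \prod_(q <- s) line q.
have {}fE : f = line p * Q by rewrite fE big_cons germ_scalerAr.
have hQ : homog (size s).-1.+1 Q by rewrite prednK; [apply/homogZ/homog_lines | lia].
have vQ : ~ vanish p Q by move=> /(vanishZ c0)/vanish_lines; apply/negP.
have htQ := @homog_tang _ p _ _ hQ.
have evtQ : ev p (tang p Q) (size s).-1 != 0.
  rewrite (ev_tang p hQ) mulf_neq0 ?pnatr_eq0 //.
  by apply/eqP => /(vanish_homog hQ).
have tQ0 : tang p Q <> 0 by move=> e; rewrite e ev0 eqxx in evtQ.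
have [c' [s' [c'0 ss' tE]]] := homog_factor htQ tQ0.
have ps' : p \notin s'.
  apply/negP => ps'; case/eqP: evtQ; rewrite tE (big_rem _ ps') evZ /=.
  by rewrite vanishMl ?mulr0 //; apply: vanish_line.
apply/(milnorE p).
have -> : tang p (f + t *: line p ^+ k.+1) = c' *: \prod_(q <- p :: s') line q.
  rewrite tangD tangZ tang_line_exp scaler0 addr0 fE tangM tang_line mul0r add0r.
  by rewrite tE -germ_scalerAr big_cons.
have dE : der p (f + t *: line p ^+ k.+1) =
    (Q + line p * der p Q) + (t * k.+1%:R) *: line p ^+ k.
  by rewrite derD derZ der_line_exp fE derM der_line mul1r mulr1 scalerA.
have hF : homog (size s) (Q + line p * der p Q).
  apply: homogD; first by rewrite -(prednK (_ : 0 < size s)%N) //; lia.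
  rewrite -[size s]prednK; last by lia.
  by rewrite -add1n; apply: homogM; [apply: homog_line | apply: homog_der].
have hL q : homog k (line q ^+ k) by rewrite -[X in homog X]muln1; apply/homog_exp/homog_line.
(* On [p] only [Q] survives in the transversal derivative, with order [size s]; on every other line
   the term in [line p ^ k] has the lowest degree, as [k < size s]. *)
pose kk q := if q == p then size s else k.
have -> : (size s + (size s).-1 * k = \sum_(q <- p :: s') kk q)%N.
  rewrite big_cons /kk eqxx; congr (_ + _)%N.
  rewrite -ss' big_seq (eq_bigr (fun=> k)) => [|q qs]; last first.
    by rewrite (negPf (_ : q != p)) //; apply: contraNneq ps' => <-.
  by rewrite -big_seq big_const_seq count_predT iter_addn_0 mulnC.
apply: codim_lines => // q qs; rewrite /kk dE.
have [->|qp] := eqVneq q p.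
  have vL : vanish p ((t * k.+1%:R) *: line p ^+ k).
    move=> d; rewrite evZ -(prednK k0) exprS vanishMl ?mulr0 //; exact: vanish_line.
  have E d : ev p (Q + line p * der p Q + (t * k.+1%:R) *: line p ^+ k) d = ev p Q d.
    by rewrite 2!evD vL addr0 [X in _ + X]vanishMl ?addr0 //; apply: vanish_line.
  split=> [i is_|]; rewrite E.
    by rewrite (ev_homog _ hQ) // prednK ?ltn_eqF // (leq_ltn_trans (leq0n i)).
  by apply/eqP; rewrite -{1}(prednK (leq_ltn_trans (leq0n k) ks)) => /(vanish_homog hQ).
have lowF i : (i <= k)%N -> ev q (Q + line p * der p Q) i = 0.
  by move=> ik; rewrite (ev_homog _ hF) // ltn_eqF // (leq_ltn_trans ik).
split=> [i ik|]; rewrite evD lowF ?(ltnW ik) // add0r evZ.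
  by rewrite (ev_homog _ (hL p)) ?mulr0 // ltn_eqF.
rewrite !mulf_neq0 ?pnatr_eq0 //.
apply/eqP => /(vanish_homog (hL p)).
have nv : ~ vanish q (line p).
  by move=> v; have /eqP := v 1%N; rewrite ev_line_eq0 (negPf qp).
elim: (k) => [v|l IH]; last by rewrite exprS => /vanishM[].
by have := @vanish_lines _ q [::]; rewrite big_nil => /(_ v).
Qed.

End Closed.

(** * The Jacobian determinant of two forms *)
Section Avoid.
Variable C : numFieldType.

Lemma poly_nonroot_small (P : {poly C}) (e : C) : P != 0 -> 0 < e ->
  exists t, [/\ 0 < t, t < e & P.[t] != 0].
Proof.
(* The fractions e/(k+2) are distinct and below [e]; [size P] of them are too many to be roots. *)
move=> P0 e0; pose r k : C := e / k.+2%:R.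
have inj : injective r.
  move=> k l /(mulfI (lt0r_neq0 e0))/invr_inj/eqP.
  by rewrite eqr_nat => /eqP[].
pose rs := [seq r k | k <- iota 0 (size P)].
have : ~~ all (root P) rs.
  apply/negP => all_r; have := max_poly_roots P0 all_r.
  by rewrite map_inj_uniq // iota_uniq size_map size_iota ltnn => /(_ isT).
case/allPn => _ /mapP[k _ ->] /negP hk; exists (r k); split.
- by rewrite divr_gt0.
- by rewrite ltr_pdivrMr // ltr_pMr // ltr1n.
- by apply/negP => h; apply: hk.
Qed.

(** Each pair excludes only the roots in [c] of a non-zero polynomial of degree at most one. *)
Lemma avoid_lines (T : eqType) (s : seq T) (a b : T -> C) :
  (forall x, x \in s -> (a x, b x) != (0, 0)) ->
  exists c, forall x, x \in s -> a x + c * b x != 0.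
Proof.
move=> ab; pose P := \prod_(x <- s) ((a x)%:P + b x *: 'X).
have P0 : P != 0.
  rewrite prodf_seq_neq0; apply/allP => x xs /=.
  apply: contra (ab x xs) => /eqP e.
  have := congr1 (fun p : {poly C} => p`_0) e; have := congr1 (fun p : {poly C} => p`_1) e.
  by rewrite !(coefE, mulr0, mulr1, addr0, add0r) /= => -> ->.
have [c [_ _ Pc]] := poly_nonroot_small P0 ltr01.
exists c => x xs; apply: contra Pc => /eqP e.
by rewrite /P (big_rem _ xs) hornerM hornerD hornerC hornerZ hornerX [_ * c]mulrC e mul0r.
Qed.

End Avoid.

Section JacobianCount.
Variable C : numClosedFieldType.
Implicit Types (f g h a b z : germ C) (p q : option C) (d e : nat).

Lemma line_exp_regular p k z : line p ^+ k * z = 0 -> z = 0.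
Proof.
elim: k => [|k IH]; first by rewrite expr0 mul1r.
by rewrite exprS -mulrA => /line_regular.
Qed.

Lemma lines_count p (s : seq (option C)) :
  \prod_(q <- s) line q = line p ^+ (count_mem p s) * \prod_(q <- s | q != p) line q.
Proof.
elim: s => [|q s IH]; first by rewrite !big_nil mul1r.
rewrite !big_cons /= IH; case: eqVneq => [->|_] /=.
  by rewrite add1n exprS mulrA.
by rewrite add0n mulrCA.
Qed.

Lemma germ_natl n f : n%:R * f = n%:R *: f.
Proof. by rewrite mulr_natl scaler_nat. Qed.

Lemma vanish_natl p n f : (0 < n)%N -> vanish p (n%:R * f) -> vanish p f.
Proof.
by move=> n0; rewrite germ_natl; apply: vanishZ; rewrite pnatr_eq0 -lt0n.
Qed.

Lemma vanishN_lines_neq p (s : seq (option C)) : ~ vanish p (\prod_(q <- s | q != p) line q).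
Proof. by rewrite -big_filter => /vanish_lines; rewrite mem_filter eqxx. Qed.

Definition jac f g : germ C := dx f * dy g - dy f * dx g.

(* By Euler's identity for [f] and [g]. *)
Lemma jac_der p n m f g : homog n f -> homog m g ->
  exists l, n%:R * f * der p g - m%:R * g * der p f = l * jac f g.
Proof.
move=> hf hg; rewrite !germ_natl -(euler hf) -(euler hg).
by case: p => [c|]; [exists (- varY) | exists varX]; rewrite /der /jac; ring.
Qed.

Section Squarefree.
Variables (F : germ C) (c : C) (s : seq (option C)).
Hypotheses (c0 : c != 0) (us : uniq s) (s0 : (0 < size s)%N).
Hypothesis FE : F = c *: \prod_(q <- s) line q.

Let hF : homog (size s) F. Proof. by rewrite FE; apply/homogZ/homog_lines. Qed.

(** Euler's identity on the line makes the tangential derivative vanish too, so the whole gradient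
    would vanish there. *)
Lemma der_nvanish p : vanish p F -> ~ vanish p (der p F).
Proof.
move=> vF vd.
have vt : vanish p (tang p F).
  apply: (@vanish_homog _ _ (size s).-1); first by apply: homog_tang; rewrite prednK.
  by rewrite ev_tang ?prednK // vF mulr0.
have [] : vanish p (dx F) /\ vanish p (dy F).
  case: (p) vd vt => [c'|] /= v v' //; split=> // d.
  by have := v' d; rewrite evD evZ v mulr0 add0r.
exact: grad_neq0 FE.
Qed.

Variables (G : germ C) (m : nat).
Hypotheses (hG : homog m G) (G0 : G <> 0) (m0 : (0 < m)%N) (ms : (m < size s)%N).

(** If the determinant were 0, [jac_der] would force every line of [F] into [G], which has too small
    a degree to contain them all. *)
Lemma jac_neq0 : jac F G <> 0.
Proof.
move=> J0; have [cG [sG [cG0 ssG GE]]] := homog_factor hG G0.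
suff /(uniq_leq_size us) : {subset s <= sG} by rewrite ssG leqNgt ms.
move=> q qs; have vF : vanish q F.
  move=> d; rewrite FE (big_rem _ qs) evZ /= vanishMl ?mulr0 //; exact: vanish_line.
have [l] := jac_der q hF hG; rewrite J0 mulr0 => /eqP; rewrite subr_eq0 => /eqP e.
have : vanish q (m%:R * G * der q F) by rewrite -e -mulrA mulrCA; apply: vanishMl.
case/vanishM => [/(vanish_natl m0)|/(der_nvanish vF)//]; rewrite GE.
by move/(vanishZ cG0)/vanish_lines.
Qed.

(* If [line p ^ e] exactly divides [G] and [line p ^ e.+1] divides the Jacobian, then
   [jac_der] forces first [line p | F] and then, as [e * size s > m], [line p ^ 2 | F]. *)
Lemma jac_count p (cG cJ : C) (sG sJ : seq (option C)) : cG != 0 -> cJ != 0 ->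
  G = cG *: \prod_(q <- sG) line q -> jac F G = cJ *: \prod_(q <- sJ) line q ->
  vanish p (dx G) -> vanish p (dy G) -> (count_mem p sJ <= count_mem p sG)%N.
Proof.
move=> cG0 cJ0 GE JE vx vy.
have vG : vanish p G.
  apply: (vanish_natl m0); rewrite germ_natl -(euler hG) => d.
  by rewrite evD [varX * _]mulrC [varY * _]mulrC !vanishMl ?addr0.
have : p \in sG by apply: vanish_lines; apply: (vanishZ cG0); rewrite -GE.
rewrite -has_pred1 has_count; case e: (count_mem p sG) => [//|k] _.
rewrite leqNgt; apply/negP => lek.
have [l] := jac_der p hF hG.
rewrite JE (lines_count p) -(subnK lek) addnC exprD.
set r := line p ^+ (_ - _); set t := \prod_(_ <- _ | _) _ => rel.
pose b := cG *: \prod_(q <- sG | q != p) line q.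
have nb : ~ vanish p b by move/(vanishZ cG0); apply: vanishN_lines_neq.
have Gb : G = line p ^+ k.+1 * b by rewrite GE (lines_count p) e -germ_scalerAr.
have dG : der p G = k.+1%:R * line p ^+ k * b + line p ^+ k.+1 * der p b.
  by rewrite Gb derM der_line_exp der_line mulr1 -germ_natl.
pose w := l * (cJ *: (r * t)).
set N := size s in rel; set d1 := der p F in rel.
(* The relation [rel] divided by [line p ^ k]. On the line only N (k+1) F b is left on the left-hand
   side. *)
have rel1 : N%:R * F * (k.+1%:R * b + line p * der p b) - m%:R * (line p * b) * d1 =
    line p ^+ 2 * w.
  apply/eqP; rewrite -subr_eq0; apply/eqP; apply: (@line_exp_regular p k).
  have -> : line p ^+ k * (N%:R * F * (k.+1%:R * b + line p * der p b) -
       m%:R * (line p * b) * d1 - line p ^+ 2 * w) =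
     (N%:R * F * der p G - m%:R * G * d1) - line p ^+ k.+2 * w.
    by rewrite dG Gb !exprS; ring.
  rewrite rel /w -!germ_scalerAr -!mulrA germ_scalerAr; apply/eqP; rewrite subr_eq0; apply/eqP.
  rewrite -!germ_scalerAr; congr (_ *: _); ring.
have vF : vanish p F.
  apply: (@vanish_natl _ (N * k.+1)); first by rewrite muln_gt0 s0.
  suff /vanishM[//|/nb//] : vanish p ((N * k.+1)%:R * F * b).
  have -> : (N * k.+1)%:R * F * b = line p * (line p * w + m%:R * b * d1 - N%:R * F * der p b)
    + (N%:R * F * (k.+1%:R * b + line p * der p b) - m%:R * (line p * b) * d1 - line p ^+ 2 * w).
    by rewrite natrM; ring.
  by rewrite rel1 subrr addr0; apply: vanishMl; apply: vanish_line.
have [z Fz] := line_dvd vF.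
have d1E : d1 = z + line p * der p z by rewrite /d1 Fz derM der_line mul1r.
(* One more division by the line, after substituting [F = line p * z]. On the line it reads (N (k+1)
   - m) z b = 0, with a positive integer factor. *)
have rel2 : N%:R * z * (k.+1%:R * b + line p * der p b) - m%:R * b * (z + line p * der p z) =
    line p * w.
  apply/eqP; rewrite -subr_eq0; apply/eqP; apply: (@line_regular _ p).
  rewrite mulrBr [X in _ - X]mulrA -expr2 -rel1 d1E Fz; ring.
have Nkm : (m < N * k.+1)%N by rewrite (leq_trans ms) // leq_pmulr.
have vz : vanish p z.
  apply: (@vanish_natl _ (N * k.+1 - m)); first by rewrite subn_gt0.
  suff /vanishM[//|/nb//] : vanish p ((N * k.+1 - m)%:R * z * b).
  have -> : (N * k.+1 - m)%:R * z * b =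
      line p * (w + m%:R * b * der p z - N%:R * z * der p b)
    + (N%:R * z * (k.+1%:R * b + line p * der p b) - m%:R * b * (z + line p * der p z)
       - line p * w).
    by rewrite natrB ?natrM 1?ltnW //; ring.
  by rewrite rel2 subrr addr0; apply: vanishMl; apply: vanish_line.
apply: (der_nvanish vF); rewrite -/d1 d1E => d.
by rewrite evD vz [X in _ + X]vanishMl ?addr0 //; apply: vanish_line.
Qed.

End Squarefree.
End JacobianCount.

(** * The Milnor number of a reduced form plus a form of lower degree *)

Section HomogeneousDeformation.
Variable C : numClosedFieldType.
Implicit Types (f g h a b z : germ C) (p q : option C) (d e : nat).

Lemma sum_if_const (T : Type) (P : pred T) (s : seq T) N k : (k <= N)%N ->
  (\sum_(x <- s) (if P x then N else k) = size s * k + count P s * (N - k))%N.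
Proof.
move=> kN; elim: s => [|x s IH]; first by rewrite big_nil.
rewrite big_cons IH /= !mulnDl mulSn addnACA; congr (_ + _)%N.
by case: (P x); rewrite ?mul1n ?subnKC // mul0n addn0.
Qed.

(** [N] and [k] are the degrees of the derivatives of [F] and [G]. On a [bad] line [D G] vanishes
    for every [D], so there the order of [D H] comes from [D F] alone. *)
Lemma milnor_homog_deform (F G : germ C) (c : C) (s : seq (option C)) N k :
  c != 0 -> uniq s -> size s = N.+1 -> F = c *: \prod_(q <- s) line q ->
  homog k.+1 G -> G <> 0 -> (k < N)%N ->
  exists2 m, milnor (F + G) m & (m <= k * k + k.+1 * (N - k))%N.
Proof.
move=> c0 us ss FE hG G0 kN.
have s0 : (0 < size s)%N by rewrite ss.
have ks : (k.+1 < size s)%N by rewrite ss.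
have hF : homog N.+1 F by rewrite -ss FE; apply/homogZ/homog_lines.
have hFx := homog_dx hF; have hFy := homog_dy hF.
have hGx := homog_dx hG; have hGy := homog_dy hG.
have J0 := jac_neq0 c0 us s0 FE hG G0 (ltn0Sn k) ks.
have hJ : homog (N + k) (jac F G).
  by apply: homogD; [|apply: homogN]; apply: homogM.
have [cJ [sJ [cJ0 sJs JE]]] := homog_factor hJ J0.
have [cG [sG [cG0 sGs GE]]] := homog_factor hG G0.
pose bad p := (ev p (dx G) k == 0) && (ev p (dy G) k == 0).
have badP p : bad p -> vanish p (dx G) /\ vanish p (dy G).
  by move=> /andP[/eqP/(vanish_homog hGx) ? /eqP/(vanish_homog hGy) ?].
have bad_le : (count bad sJ <= k.+1)%N.
  rewrite -sGs -size_filter.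
  (* The bad factors of the determinant form a sub-multiset of the factors of [G], so there are at
     most deg G of them. *)
  have /count_subseqP[t /size_subseq ts /perm_size ->] : forall p,
      (count_mem p [seq x <- sJ | bad x] <= count_mem p sG)%N => [p|//].
  rewrite count_filter; have [bp|nbp] := boolP (bad p); last first.
    rewrite (@eq_count _ _ pred0) ?count_pred0 // => q /=.
    by case: eqP => // ->; rewrite (negPf nbp).
  have [vx vy] := badP p bp.
  apply: leq_trans (jac_count c0 us s0 FE hG (ltn0Sn k) ks cG0 cJ0 GE JE vx vy).
  by apply: sub_count => q /andP[].
(* A direction [D = dx + u dy] not killing [F] and [G] simultaneously on any line of [J]. *)
have [u hu] : exists u, forall p, p \in sJ ->
    (if bad p then ev p (dx F) N else ev p (dx G) k) +
    u * (if bad p then ev p (dy F) N else ev p (dy G) k) != 0.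
  apply: avoid_lines => p _; rewrite xpair_eqE.
  case: ifPn => // bp; apply/negP => /andP[/eqP x0 /eqP y0].
  exact: (grad_neq0 c0 us s0 FE (vanish_homog hFx x0) (vanish_homog hFy y0)).
(* The scalar [u] as a germ, so that [ring] sees scaling as a product. *)
have [U uE] : exists U, forall x : germ C, u *: x = U * x.
  by exists u%:A => x; rewrite mulr_algl.
pose D f := dx f + u *: dy f.
have DF : homog N (D F) by apply: homogD => //; apply: homogZ.
have DG : homog k (D G) by apply: homogD => //; apply: homogZ.
have JD : jac F G = D F * dy G - dy F * D G.
  by rewrite /D /jac !uE; ring.
have ev_D p f d : ev p (D f) d = ev p (dx f) d + u * ev p (dy f) d.
  by rewrite evD evZ.
have hsJ p : p \in sJ -> if bad p then vanish p (D G) /\ ev p (D F) N != 0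
    else ev p (D G) k != 0.
  move=> ps; have := hu p ps; case: ifP => [/badP[vx vy]|_]; rewrite -ev_D // => ->.
  by split=> // d; rewrite ev_D vx vy mulr0 addr0.
have nDFG p : vanish p (D F) -> vanish p (D G) -> False.
  move=> vF vG.
  have vJ : vanish p (jac F G).
    by move=> d; rewrite JD evD evN [dy F * _]mulrC !vanishMl ?subr0.
  have ps : p \in sJ by apply: vanish_lines; apply: (vanishZ cJ0); rewrite -JE.
  by have := hsJ p ps; case: ifP => _; rewrite ?vF ?vG eqxx // => -[].
(* Otherwise a line of [D F], which has positive degree, would be common to [D F] and [D G]. *)
have DG0 : D G <> 0.
  move=> e; have hDF := DF; rewrite -(prednK (_ : 0 < N)%N) in hDF; last by lia.
  have [p /(vanish_homog hDF) vp] := homog_root hDF.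
  by apply: (nDFG p) => //; rewrite e => d; apply: ev0.
have [cD [sD [cD0 sDs DE]]] := homog_factor DG DG0.
pose a := D F + D G.
have a_low p i : (i < k)%N -> ev p a i = 0.
  by move=> ik; rewrite evD (ev_homog _ DF) ?(ev_homog _ DG) ?addr0 //; lia.
have a_k p : ev p a k = ev p (D G) k.
  by rewrite evD (ev_homog _ DF) ?add0r //; lia.
have a_N p : vanish p (D G) -> forall i, ev p a i = ev p (D F) i.
  by move=> v i; rewrite evD v addr0.
pose kk p := if bad p then N else k.
have cdJ : codim_is (ideal2 a (jac F G)) (\sum_(p <- sJ) kk p)%N.
  rewrite JE; apply: codim_lines => // p ps; rewrite /kk.
  have := hsJ p ps; case: ifP => _ => [[vG nF]|nG]; last first.
    by split=> [i|]; [exact: a_low | rewrite a_k].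
  by rewrite !a_N //; split=> // i iN; rewrite a_N // (ev_homog _ DF) // ltn_eqF.
have sD_nv q : q \in sD -> vanish q (D G) /\ ev q (D F) N != 0.
  move=> qs; have vG : vanish q (D G).
    by move=> d; rewrite DE (big_rem _ qs) evZ /= vanishMl ?mulr0 //; apply: vanish_line.
  by split=> //; apply/eqP => /(vanish_homog DF) vF; apply: (nDFG q).
have cdD : codim_is (ideal2 a (D G)) (k * N)%N.
  have := @codim_lines _ a sD (fun=> N) cD cD0.
  rewrite -DE big_const_seq count_predT iter_addn_0 sDs mulnC; apply=> q qs.
  have [vG nF] := sD_nv q qs; split=> [i iN|]; rewrite a_N //.
  by rewrite (ev_homog _ DF) // ltn_eqF.
(* Modulo [a] one may replace [D F] by [- D G]; the substitution of coefficients is its own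
   inverse. *)
have JH h : ideal2 a (jac F G) h <-> ideal2 a (D G * dy (F + G)) h.
  rewrite JD dyD; split=> -[v [w ->]].
    by exists (v + w * dy G), (- w); rewrite /a; ring.
  by exists (v + w * dy G), (- w); rewrite /a; ring.
have cdJ' := codim_ext JH cdJ.
have [m hm] : exists m, codim_is (ideal2 a (dy (F + G))) m.
  apply: codim_ex (cdJ'); try exact: ideal2_closed.
  by move=> h [v [w ->]]; exists v, (w * D G); rewrite mulrA.
exists m.
  apply: codim_ext hm => h; rewrite /ideal2 /jacobian_ideal /= /a /D !dxD !dyD.
  split=> -[v [w ->]].
    by exists v, (w + u *: v); rewrite !uE; ring.
  by exists v, (w - u *: v); rewrite !uE; ring.
have reg z w : D G * z = a * w -> exists w', z = a * w'.
  move=> e; apply: (@lines_regular_mod _ a sD z (cD^-1 *: w)) => [q qs va|].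
    by have [vG] := sD_nv q qs; rewrite -a_N // va eqxx.
  by rewrite -germ_scalerAr -e DE -scalerAl scalerA mulVf ?scale1r.
(* Additivity compares [(N + k) * k + r * (N - k)], with [r] the number of bad factors, to [k * N]
   plus the Milnor number, which is thus [k * k + r * (N - k)]. *)
have := codim_uniq (@ideal2_closed _ _ _) cdJ' (codim_ideal2_mul reg cdD hm).
rewrite /kk (sum_if_const bad sJ (ltnW kN)) sJs.
move: bad_le; set r := count _ _ => rk e.
have kNk : (k * N = k * k + k * (N - k))%N by rewrite -mulnDr subnKC // ltnW.
have : (r * (N - k) <= k.+1 * (N - k))%N by rewrite leq_mul2r rk orbT.
rewrite mulnDl in e; rewrite [(N * k)%N]mulnC in e; lia.
Qed.

End HomogeneousDeformation.

(** * Semicontinuity *)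
Section Semicontinuity.
Variable C : numFieldType.
Implicit Types (f g h : germ C) (p : option C).

Definition univariate p f :=
  forall i j, (if p is Some _ then i else j) != 0%N -> f i j = 0.

Lemma univariateM p f g : univariate p f -> univariate p g -> univariate p (f * g).
Proof.
move=> hf hg i j; rewrite germ_coefM.
case: p hf hg => [c|] hf hg ij; rewrite big1 // => k _; rewrite big1 // => l _.
- case: (posnP k) => [k0|]; last by rewrite lt0n => /hf ->; rewrite mul0r.
  by rewrite hg ?mulr0 // k0 subn0.
- case: (posnP l) => [l0|]; last by rewrite lt0n => /hf ->; rewrite mul0r.
  by rewrite hg ?mulr0 // l0 subn0.
Qed.

Lemma univariateB p f g : univariate p f -> univariate p g -> univariate p (f - g).
Proof. by move=> hf hg i j ij; rewrite germ_coefB hf ?hg ?subr0. Qed.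

Lemma univariate_param p k : univariate p (param p k).
Proof. by case: p => [c|] i j /negPf /= h; rewrite /ser_mono h ?andbF. Qed.

(** A one-variable germ is determined by its restriction, so identities on the line become
    identities of germs. *)
Lemma univariate_vanish p f : univariate p f -> vanish p f -> f = 0.
Proof.
move=> hf vf; apply: germP => i j; rewrite germ_coef0.
case: p hf vf => [c|] hf vf.
  case: (posnP i) => [->|]; last by rewrite lt0n => /hf.
  have := vf j; rewrite evSome big_ord_recl /= subn0 expr0 mulr1 big1 ?addr0 // => k _.
  by rewrite hf ?mul0r.
case: (posnP j) => [->|]; last by rewrite lt0n => /hf.
by rewrite -evNone vf.
Qed.

(* The powers [param p 0, ..., param p m] are linearly dependent modulo the ideal, and the
   relation is [param p k] times a unit for some [k <= m]. *)
Lemma param_in_ideal a b p m : codim_is (@ideal2 C a b) m -> ideal2 a b (param p m).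
Proof.
have lI := @ideal2_closed C a b; move=> /(codimP _ lI)[phi [surj ker]].
pose M : 'M[C]_(m.+1, m) := \matrix_(i < m.+1) phi (param p i).
have : kermx M != 0.
  by rewrite kermx_eq0 /row_free neq_ltn (leq_ltn_trans (rank_leq_col M)).
case/rowV0Pn => c /sub_kermxP cM c0.
pose q := \sum_(i < m.+1) c 0 i *: param p i.
have Iq : ideal2 a b q.
  apply/ker; rewrite linear_sum -[RHS]cM mulmx_sum_row; apply: eq_bigr => i _.
  by rewrite linearZ /= rowK.
have evq d : ev p q d = if insub d is Some i then c 0 i else 0.
  rewrite ev_sum; case: insubP => [i _ id|dm].
    rewrite (bigD1 i) //= evZ ev_param id eqxx mulr1 big1 ?addr0 // => l li.
    rewrite evZ ev_param (_ : (d == l) = false) ?mulr0 //.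
    by apply: contraNF li => /eqP dl; apply/eqP/val_inj; rewrite id.
  rewrite big1 // => i _; rewrite evZ ev_param gtn_eqF ?mulr0 //.
  by rewrite (leq_trans (ltn_ord i)) // leqNgt.
have nvq : ~ vanish p q.
  move=> v; case/eqP: c0; apply/rowP => i; rewrite mxE.
  by have := v i; rewrite evq valK.
have [k [qk qlow]] := vanishPn nvq.
have km : (k <= m)%N.
  by move: qk; rewrite evq; case: insubP => [i|]; rewrite ?eqxx // ltnS.
have plow i : (i < k)%N -> ev p (param p k) i = 0.
  by move=> ik; rewrite ev_param ltn_eqF.
have [u [cu hu]] := ev_divide qlow qk plow.
have uq : univariate p q.
  move=> i j ij; rewrite germ_coef_sum big1 // => l _.
  by rewrite germ_coefZ (univariate_param _ ij) mulr0.
have uu : univariate p (Germ _ cu).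
  by move=> i j /=; rewrite /uni_coef; case: (p) => [c'|] /negPf ->.
have /eqP := univariate_vanish (univariateB (@univariate_param p k) (univariateM uq uu))
  (hu (Germ _ cu) erefl).
rewrite subr_eq0 => /eqP pk.
have -> : param p m = param p (m - k) * param p k.
  by case: (p) => [c'|]; rewrite /param germ_monoD subnK.
by rewrite pk; apply: ideal2M; rewrite mulrC; apply: ideal2M.
Qed.

Lemma germ_box h m : exists f g,
  h = \sum_(x : 'I_m * 'I_m) h x.1 x.2 *: germ_mono C x.1 x.2
      + (germ_mono C m 0 * f + germ_mono C 0 m * g).
Proof.
(* [b] is cut to exponents of x below [m]: monomials with both exponents at least [m] already belong
   to [a]. *)
pose a i j := h (i + m)%N j; pose b i j := if (i < m)%N then h i (j + m)%N else 0.
have ca : convergent a.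
  apply: (@convergent_dom _ h _ m 0 1) => // [|i j]; first exact: coefP.
  by rewrite expr1n mulr1 addn0.
have cb : convergent b.
  apply: (@convergent_dom _ h _ 0 m 1) => // [|i j]; first exact: coefP.
  by rewrite expr1n mulr1 addn0 /b; case: ifP; rewrite ?normr0.
exists (Germ _ ca), (Germ _ cb); apply: germP => i j.
rewrite !germ_coefD !germ_monoM /= !subn0 andbT /a /b germ_coef_sum.
have E (x : 'I_m * 'I_m) : (h x.1 x.2 *: germ_mono C x.1 x.2) i j =
    if (x.1 == i :> nat) && (x.2 == j :> nat) then h i j else 0.
  rewrite germ_coefZ /= /ser_mono ![_ == nat_of_ord _]eq_sym.
  by case: eqP => [->|] /=; rewrite ?mulr0 //; case: eqP => [->|]; rewrite ?mulr0 ?mulr1.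
under eq_bigr do rewrite E.
have S0 : ~~ ((i < m) && (j < m))%N ->
    \sum_(x : 'I_m * 'I_m) (if (x.1 == i :> nat) && (x.2 == j :> nat) then h i j else 0) = 0.
  move=> ij; rewrite big1 // => x _; case: ifP => // /andP[/eqP xi /eqP xj].
  by rewrite -xi -xj !ltn_ord in ij.
case: (ltnP i m) S0 => [im|mi] S0; last by rewrite S0 // subnK // add0r if_same addr0.
case: (ltnP j m) S0 => [jm|mj] S0; last by rewrite S0 // subnK // !add0r.
rewrite addr0 (bigD1 (Ordinal im, Ordinal jm)) //= !eqxx addr0 big1 ?addr0 // => -[x y] /= xy.
by case: ifP => // /andP[/eqP xi /eqP yj]; case/eqP: xy; congr pair; apply: val_inj.
Qed.

(** At t = 0 each monomial of the m x m box is a combination of the basis [e] plus an element of the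
    ideal. Keeping the coefficients and moving the generators to t gives germs [hl l t] in the span
    of [e] modulo the ideal at t. Their box coefficients form a matrix polynomial in t, equal to the
    identity at 0; where its determinant is non-zero, the [mu] classes of [e] span the quotient at
    t. *)
Lemma codim_semicont (a b : C -> germ C) (pa pb : nat -> nat -> {poly C}) mu m :
  (forall t i j, a t i j = (pa i j).[t]) -> (forall t i j, b t i j = (pb i j).[t]) ->
  codim_is (ideal2 (a 0) (b 0)) mu ->
  exists2 P : {poly C}, P != 0 &
    forall t, P.[t] != 0 -> codim_is (ideal2 (a t) (b t)) m -> (m <= mu)%N.
Proof.
move=> aE bE [e he].
pose N := #|{: 'I_m * 'I_m}|.
pose tI (l : 'I_N) : 'I_m * 'I_m := enum_val l.
have tI_inj : injective tI by exact: enum_val_inj.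
pose mono (l : 'I_N) := germ_mono C (tI l).1 (tI l).2.
have /choice[r hr] : forall l, exists r : 'rV[C]_mu * (germ C * germ C),
    mono l = \sum_i r.1 0 i *: e i + (r.2.1 * a 0 + r.2.2 * b 0).
  move=> l; have [c [[u [v huv]] _]] := he (mono l).
  by exists (c, (u, v)); rewrite /= -huv addrC subrK.
pose hl l t : germ C := \sum_i (r l).1 0 i *: e i + ((r l).2.1 * a t + (r l).2.2 * b t).
pose pconv (u : germ C) (w : nat -> nat -> {poly C}) i j :=
  \sum_(k < i.+1) \sum_(l < j.+1) (u k l)%:P * w (i - k)%N (j - l)%N.
have pconvE u w (f : germ C) t i j : (forall i j, f i j = (w i j).[t]) ->
    (u * f) i j = (pconv u w i j).[t].
  move=> fE; rewrite germ_coefM horner_sum; apply: eq_bigr => k _.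
  by rewrite horner_sum; apply: eq_bigr => l _; rewrite hornerM hornerC fE.
pose q l i j := ((\sum_k (r l).1 0 k *: e k) i j)%:P +
  (pconv (r l).2.1 pa i j + pconv (r l).2.2 pb i j).
have qE l t i j : (q l i j).[t] = hl l t i j.
  by rewrite 2!hornerD hornerC /hl !germ_coefD (pconvE _ pa _ t) // (pconvE _ pb _ t).
pose M : 'M[{poly C}]_N := \matrix_(l, k) q l (tI k).1 (tI k).2.
pose Mt t := map_mx (horner_eval t) M.
have detE t : (\det M).[t] = \det (Mt t) by rewrite det_map_mx.
have M0 : Mt 0 = 1%:M.
  apply/matrixP => l k; rewrite !mxE /horner_eval qE /hl -hr /= /ser_mono.
  rewrite [(_ == _ :> nat)]eq_sym [X in _ && X]eq_sym.
  rewrite -(inj_eq tI_inj) -[in RHS]pair_eqE /pair_eq /=.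
  by case: (tI l) (tI k) => [x y] [x' y'].
exists (\det M).
  by apply/eqP => d0; have /eqP := detE 0; rewrite d0 M0 det1 horner0 eq_sym oner_eq0.
move=> t; rewrite detE => Mt0 cdt.
(* With x^m and y^m in the ideal, a class depends only on the coefficients in the box. *)
have xm := param_in_ideal None cdt; have ym := param_in_ideal (Some 0) cdt.
have lI := @ideal2_closed C (a t) (b t).
case/(codimP _ lI): cdt => phi [surj ker].
pose Phi : 'M[C]_(N, m) := \matrix_l phi (mono l).
pose E : 'M[C]_(mu, m) := \matrix_i phi (e i).
have phiE h : phi h = (\row_l h (tI l).1 (tI l).2) *m Phi.
  have [f [g {1}->]] := germ_box h m.
  rewrite linearD /= [X in _ + X](_ : _ = 0) ?addr0; last first.
    by apply/ker; apply: (lin_closedD lI); rewrite mulrC; apply: ideal2M.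
  rewrite linear_sum mulmx_sum_row (reindex tI) /=; last first.
    exact/onW_bij/enum_val_bij.
  by apply: eq_bigr => l _; rewrite linearZ /= rowK mxE.
have full : (1%:M <= Phi)%MS.
  apply/row_subP => i; have [h <-] := surj (row i 1%:M).
  by rewrite phiE submxMl.
have eqM : Mt t *m Phi = (\matrix_l (r l).1) *m E.
  apply/row_matrixP => l; rewrite !row_mul rowK.
  have -> : row l (Mt t) = \row_k hl l t (tI k).1 (tI k).2.
    by apply/rowP => k; rewrite !mxE /horner_eval qE.
  rewrite -phiE /hl linearD /= [X in _ + X](_ : _ = 0) ?addr0; last first.
    by apply/ker; exists (r l).2.1, (r l).2.2.
  by rewrite linear_sum mulmx_sum_row; apply: eq_bigr => i _; rewrite linearZ /= rowK.
have uM : row_full (Mt t) by rewrite row_full_unit unitmxE unitfE.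
have := mxrankS full; rewrite mxrank1 => /leq_trans; apply.
rewrite -(eqmxMfull Phi uM) eqM.
exact: leq_trans (mxrankM_maxr _ _) (rank_leq_row _).
Qed.

End Semicontinuity.

(** * Rescaling and the jump *)
Section Scaling.
Variable C : numFieldType.
Implicit Types (f g h : germ C) (t c : C).

Let dilate_coef t f i j : C := f i j * t ^+ (i + j).

Let dilate_convergent t f : convergent (dilate_coef t f).
Proof.
apply: (@convergent_dom _ f _ 0 0 `|t|) => // [|i j]; first exact: coefP.
by rewrite !addn0 normrM normrX.
Qed.

Definition dilate t f := Germ _ (dilate_convergent t f).

Lemma dilateE t f i j : dilate t f i j = f i j * t ^+ (i + j).
Proof. by []. Qed.

Lemma dilateD t f g : dilate t (f + g) = dilate t f + dilate t g.
Proof. by apply: germP => i j; rewrite germ_coefD !dilateE germ_coefD mulrDl. Qed.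

Lemma dilateZ t c f : dilate t (c *: f) = c *: dilate t f.
Proof. by apply: germP => i j; rewrite germ_coefZ !dilateE germ_coefZ mulrA. Qed.

Lemma dilateM t f g : dilate t (f * g) = dilate t f * dilate t g.
Proof.
apply: germP => i j; rewrite dilateE !germ_coefM mulr_suml; apply: eq_bigr => k _.
rewrite mulr_suml; apply: eq_bigr => l _; rewrite !dilateE mulrACA -exprD.
by rewrite addnACA !subnKC // -ltnS.
Qed.

Lemma dilateK t f : t != 0 -> dilate t^-1 (dilate t f) = f.
Proof.
by move=> t0; apply: germP => i j; rewrite !dilateE -mulrA -exprMn divff // expr1n mulr1.
Qed.

Lemma dx_dilate t f : dx (dilate t f) = t *: dilate t (dx f).
Proof.
apply: germP => i j; rewrite germ_coefZ dxE !dilateE dxE addSn exprS.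
by rewrite mulrnAl mulrnAr mulrCA.
Qed.

Lemma dy_dilate t f : dy (dilate t f) = t *: dilate t (dy f).
Proof.
apply: germP => i j; rewrite germ_coefZ dyE !dilateE dyE addnS exprS.
by rewrite mulrnAl mulrnAr mulrCA.
Qed.

Let jacobian_dilate c t f h : c != 0 -> t != 0 -> jacobian_ideal f h ->
  jacobian_ideal (c *: dilate t f) (dilate t h).
Proof.
move=> c0 t0 [u [v ->]]; exists ((c * t)^-1 *: dilate t u), ((c * t)^-1 *: dilate t v).
rewrite dxZ dyZ dx_dilate dy_dilate !scalerA -!scalerAl -!germ_scalerAr !scalerA.
by rewrite mulVf ?mulf_neq0 // !scale1r dilateD !dilateM.
Qed.

(** Rescaling the coordinates is an automorphism of the ring that matches the two Jacobian
    ideals. *)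
Lemma milnor_dilate c t f m : c != 0 -> t != 0 ->
  milnor f m -> milnor (c *: dilate t f) m.
Proof.
move=> c0 t0 [e he]; exists (fun k => dilate t (e k)) => h.
have tV0 : t^-1 != 0 by rewrite invr_eq0.
have dV g : dilate t (dilate t^-1 g) = g by rewrite -{1}[t]invrK dilateK.
have dE (x : 'rV[C]_m) : h - \sum_k x 0 k *: dilate t (e k) =
    dilate t (dilate t^-1 h - \sum_k x 0 k *: e k).
  rewrite dilateD dV -scaleN1r dilateZ scaleN1r; congr (_ - _).
  elim/big_ind2: _ => [|x1 x2 y1 y2 -> ->|k _]; last by rewrite dilateZ.
  - by rewrite -(scale0r 0) dilateZ !scale0r.
  - by rewrite dilateD.
have [x [Jx ux]] := he (dilate t^-1 h).
exists x; split=> [|x' Jx']; first by rewrite dE; apply: jacobian_dilate.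
apply: ux; move: Jx'; rewrite dE => Jx'.
have := jacobian_dilate (invr_neq0 c0) tV0 Jx'.
by rewrite dilateZ !dilateK // scalerA mulVf // scale1r.
Qed.

Let family_coef g (j : nat) t (i k : nat) : C := g i k * t ^+ (i + k - j).

Let family_convergent g j t : convergent (family_coef g j t).
Proof.
have t1 : 0 <= 1 + `|t| by rewrite addr_ge0.
apply: (@convergent_dom _ g _ 0 0 (1 + `|t|)) => // [|i k]; first exact: coefP.
rewrite !addn0 normrM normrX ler_wpM2l //.
apply: (@le_trans _ _ ((1 + `|t|) ^+ (i + k - j))).
  by rewrite lerXn2r ?nnegrE // lerDr.
by rewrite ler_weXn2l ?leq_subr // lerDl.
Qed.

(* For [g] of order [j] this is [t^-j g (t x, t y)], extended to [t = 0] by the initial form. *)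
Definition family g j t := Germ _ (family_convergent g j t).

Lemma familyE g j t i k : family g j t i k = g i k * t ^+ (i + k - j).
Proof. by []. Qed.

Lemma dilate_family n j (F g : germ C) t : t != 0 -> (j <= n)%N -> homog n F ->
  (forall i k, (i + k < j)%N -> g i k = 0) ->
  t ^- n *: dilate t (F + t ^+ (n - j) *: g) = F + family g j t.
Proof.
move=> t0 jn hF glow; apply: germP => i k.
rewrite germ_coefZ dilateE !germ_coefD germ_coefZ familyE mulrDl mulrDr; congr (_ + _).
  have [<-|ik] := eqVneq (i + k)%N n; first by rewrite mulrCA mulVf ?mulr1 ?expf_neq0.
  by rewrite hF // mul0r mulr0.
case: (ltnP (i + k) j) => ik; first by rewrite glow // mulr0 !mul0r mulr0.
rewrite mulrC -mulrA -mulrA mulrCA; congr (_ * _).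
rewrite mulrA -exprD (_ : n - j + (i + k) = (i + k - j) + n)%N; last by lia.
by rewrite exprD mulfK // expf_neq0.
Qed.

Lemma family0_homog g j : (forall i k, (i + k < j)%N -> g i k = 0) -> homog j (family g j 0).
Proof.
move=> glow i k ik; rewrite familyE expr0n subn_eq0.
case: (ltngtP (i + k) j) ik => // ik _; first by rewrite glow // mul0r.
by rewrite mulr0.
Qed.

Lemma milnor_family_le (F g : germ C) j mu m : milnor (F + family g j 0) mu ->
  exists2 P : {poly C}, P != 0 &
    forall t, P.[t] != 0 -> milnor (F + family g j t) m -> (m <= mu)%N.
Proof.
pose pa i k := ((F i.+1 k)%:P + g i.+1 k *: 'X^(i.+1 + k - j)) *+ i.+1.
pose pb i k := ((F i k.+1)%:P + g i k.+1 *: 'X^(i + k.+1 - j)) *+ k.+1.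
apply: (@codim_semicont _ (fun t => dx (F + family g j t)) (fun t => dy (F + family g j t)) pa pb).
  move=> t i k; rewrite dxE germ_coefD familyE /pa hornerMn hornerD hornerC hornerZ.
  by rewrite hornerXn.
move=> t i k; rewrite dyE germ_coefD familyE /pb hornerMn hornerD hornerC hornerZ.
by rewrite hornerXn.
Qed.

Lemma linear_form_line (l : C * C) : l != (0, 0) ->
  exists c p, c != 0 /\ linear_form l = c *: line p.
Proof.
case: l => a b; rewrite xpair_eqE /linear_form /=; have [->|a0] := eqVneq a 0.
  by move=> b0; exists b, None; rewrite scale0r add0r.
move=> _; exists a, (Some (- b / a)); split=> //.
by rewrite /line scalerBr scalerA mulrCA divff // mulr1 scaleNr opprK.
Qed.

Lemma homogeneous_singularity_lines n f : (1 < n)%N -> homogeneous_singularity n f ->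
  exists c (s : seq (option C)),
    [/\ c != 0, uniq s, size s = n & f = c *: \prod_(p <- s) line p].
Proof.
move=> n1 [l [hl ->]].
have l0 i : l i != (0, 0).
  apply/eqP => li.
  (* A zero form would be proportional to any other factor, and [1 < n] supplies one. *)
  have [k ik] : exists k : 'I_n, i != k.
    have [i0|i0] := eqVneq i (Ordinal (ltnW n1)); last by exists (Ordinal (ltnW n1)).
    by exists (Ordinal n1); rewrite i0.
  by apply: (hl _ _ ik); exists 0; rewrite li /linear_form /= !scale0r addr0.
have /choice[r hr] : forall i, exists r : C * option C,
    r.1 != 0 /\ linear_form (l i) = r.1 *: line r.2.
  by move=> i; have [c [p h]] := linear_form_line (l0 i); exists (c, p).
exists (\prod_i (r i).1), [seq (r i).2 | i <- enum 'I_n]; split.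
- by apply/prodf_neq0 => i _; have [] := hr i.
- rewrite map_inj_uniq ?enum_uniq // => i k rik.
  apply/eqP; apply: contrapT => /negP /hl; apply.
  exists ((r i).1 / (r k).1); rewrite (hr i).2 (hr k).2 rik scalerA divfK //.
  by have [] := hr k.
- by rewrite size_map size_enum_ord.
- rewrite big_map big_enum /=.
  elim/big_rec3: _ => [|i x y z _ ->]; first by rewrite scale1r.
  by rewrite (hr i).2 -scalerAl -germ_scalerAr scalerA.
Qed.

End Scaling.

(** [N] and [k] stand for n - 1 and j - 1: the Milnor number of [f0] is the value attained by the
    special deformation plus the jump. *)
Lemma jump_arith_eq N k : (k < N)%N ->
  (N * N = N + N.-1 * k + (N.+1 - k.+1) * (N.+1 - 2))%N.
Proof.
move=> kN; have [d dE] : exists d, N = (k + d).+1 by exists (N - k).-1; lia.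
have -> : (N.+1 - k.+1 = d.+1)%N by lia.
have -> : (N.+1 - 2 = k + d)%N by lia.
by rewrite dE /=; lia.
Qed.

Lemma jump_arith_le N k m e : (k < N)%N -> (N * N = m + e)%N ->
  (m <= k * k + k.+1 * (N - k))%N -> ((N.+1 - k.+1) * (N.+1 - 2) <= e)%N.
Proof.
move=> kN NN; have -> : (k * k + k.+1 * (N - k) = N + N.-1 * k)%N.
  have [d dE] : exists d, N = (k + d).+1 by exists (N - k).-1; lia.
  have -> : (N - k = d.+1)%N by lia.
  by rewrite dE /=; lia.
by move=> le_m; move: NN; rewrite (jump_arith_eq kN); lia.
Qed.

Lemma jump_homogeneous (C : numClosedFieldType) (n j : nat) (f0 : germ C) :
  (3 <= n)%N -> (2 <= j)%N -> (j < n)%N -> homogeneous_singularity n f0 ->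
  jump_linear_order_is f0 j ((n - j) * (n - 2)).
Proof.
move=> n3 j2 jn /(homogeneous_singularity_lines (ltnW n3))[c [s [c0 us ss fE]]].
case: n n3 jn ss => [|N] // N2 jN ss; case: j j2 jN => [|k] // k1 kN.
have s1 : (1 < size s)%N by rewrite ss ltnW.
have mf0 : milnor f0 (N * N) by have := milnor_homog c0 us s1 fE; rewrite ss.
have hf0 : homog N.+1 f0 by rewrite -ss fE; apply/homogZ/homog_lines.
split; first split.
- by rewrite muln_gt0 !subn_gt0; apply/andP; split=> //; apply: ltnW.
- case: s us ss s1 fE => // p s' us [ss] _ fE; exists (line p ^+ k.+1).
  have hg : homog k.+1 (line p ^+ k.+1).
    by rewrite -[X in homog X]muln1; apply/homog_exp/homog_line.
  split; first by apply: hg.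
    split=> [i l il|]; first by apply: hg; rewrite ltn_eqF.
    apply: contrapT => ne.
    (* Without a non-zero coefficient in degree j the power itself is 0, whereas multiplication by
       it is injective. *)
    have g0 : line p ^+ k.+1 = 0.
      apply: germP => i l; rewrite germ_coef0; apply/eqP; apply: contrapT => /negP gil.
      by apply: ne; exists i, l; split=> //; apply/eqP; apply: contraNT gil => /hg ->.
    have := @line_exp_regular _ p k.+1 1; rewrite g0 mul0r => /(_ erefl) /eqP.
    by rewrite oner_eq0.
  exists (N * N)%N, (N + N.-1 * k)%N; split=> //.
    exact: jump_arith_eq.
  near=> t; have := @milnor_deform _ f0 c t p s' k c0 _ us k1 _ fE.
  rewrite ss; apply=> //.
  by near: t; apply: nbhs_dnbhs_neq.
- move=> e [e0 [g [_ [glow [i1 [k1' [ik1 gik]]]] [m0 [m [mm0 m0E near_m]]]]]].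
  have {}m0E : (N * N = m + e)%N by rewrite -m0E; apply: milnor_uniq mf0 mm0.
  have hG := family0_homog glow.
  have G0 : family g k.+1 0 <> 0.
    move=> /(congr1 (fun f : germ C => f i1 k1')); rewrite familyE ik1 subnn expr0 mulr1.
    by rewrite germ_coef0 => /eqP; rewrite (negPf gik).
  have [mu hmu mu_le] := milnor_homog_deform c0 us ss fE hG G0 kN.
  have [P P0 hP] := milnor_family_le m hmu.
  have /nbhs_ballP[eps /= eps0 heps] : nbhs (0 : C) (fun t : C => t != 0 -> milnor (f0 + t *: g) m).
    exact: near_m.
  have e1 : 0 < 1 + eps by rewrite addr_gt0.
  (* The bound eps / (1 + eps) lies below both 1 and eps, so that s = t^(n-j) <= t < eps. *)
  have [t [t0 te Pt]] := poly_nonroot_small P0 (divr_gt0 eps0 e1).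
  have t1 : t < 1.
    by apply: lt_le_trans te _; rewrite ler_pdivrMr // mul1r lerDr.
  have teps : t < eps.
    by apply: lt_le_trans te _; rewrite ler_pdivrMr // ler_peMr ?(ltW eps0) // lerDl ltW.
  have tn0 : t != 0 by rewrite gt_eqF.
  have m_mu : (m <= mu)%N.
    apply: (hP t Pt).
    rewrite -(dilate_family tn0 (ltnW (kN : (k.+1 < N.+1)%N)) hf0 glow).
    apply: milnor_dilate => //; first by rewrite invr_eq0 expf_neq0.
    apply: heps; last exact: expf_neq0.
    rewrite /ball /= sub0r normrN normrX ger0_norm ?(ltW t0) //.
    apply: le_lt_trans teps; rewrite subSS -(subnSK (kN : (k < N)%N)) exprS ger_pMr //.
    by rewrite exprn_ile1 // ltW.
  exact: (jump_arith_le (kN : (k < N)%N) m0E (leq_trans m_mu mu_le)).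
Unshelve. all: by end_near.
Qed.

Theorem theorem3p2 (R : realType) (n j : nat) (f0 : germ R[i]) :
  (3 <= n)%N -> (2 <= j)%N -> (j < n)%N ->
  homogeneous_singularity n f0 ->
  jump_linear_order_is f0 j ((n - j) * (n - 2)).
Proof. exact: jump_homogeneous. Qed.
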